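(* There is an absolute constant $c$ such that the following holds for all $n$ and all $d,r\ge 3$. Let $G_n$ be a random $d$-regular graph on $n$ vertices from the uniform model, and let $\mathcal I$ be the collection of all cycles of length $r$ or less in the complete graph $K_n$. For $\alpha\in\mathcal I$ let $I_\alpha=1\{G_n\text{ contains }\alpha\}$ and let $\mathbf I=(I_\alpha,\ \alpha\in\mathcal I)$. Let $\mathbf Z=(Z_\alpha,\ \alpha\in\mathcal I)$ be a vector whose coordinates are independent Poisson random variables with $\mathbf E Z_\alpha=(d-1)^{|\alpha|}/[n]_{|\alpha|}$, where $|\alpha|$ is the length of $\alpha$. Then $$d_{TV}(\mathbf I,\mathbf Z)\le\frac{c(d-1)^{2r-1}}{n}.$$
   Context: $[n]_k=n(n-1)\cdots(n-k+1)$; $d_{TV}(X,Y)$ is the total variation distance between the laws of $X$ and $Y$. The uniform model is the uniform distribution on the set of all simple (no loops or multiple edges) $d$-regular graphs on the labeled vertex set $\{1,\dots,n\}$; it is considered only for $n,d$ for which such graphs exist (in particular $nd$ is even). A cycle in $K_n$ is a simple cycle (closed walk repeating no vertices), identified with its set of edges, i.e. starting point and direction are ignored; its length is at least 3. *)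

(* Defs.v *)
From HB Require Import structures.
From mathcomp Require Export all_boot all_order all_algebra.
From mathcomp Require Export all_classical all_reals all_analysis.

Set Implicit Arguments.
Unset Strict Implicit.
Unset Printing Implicit Defensive.

Import Order.TTheory GRing.Theory Num.Theory.

Local Open Scope classical_set_scope.
Local Open Scope ring_scope.

(* A graph on the vertex set 'I_n is identified with its set of edges, an edge
   {u, v} being the finite set of its endpoints. *)
Definition graph (n : nat) : Type := {set {set 'I_n}}.

HB.instance Definition _ (n : nat) := Finite.on (graph n).
HB.instance Definition _ (n : nat) :=
  isPointed.Build (graph n) (finset.set0 : {set {set 'I_n}}).
HB.instance Definition _ (n : nat) :=
  @isMeasurable.Build default_measure_display (graph n)
    discrete_measurable discrete_measurable0
    discrete_measurableC discrete_measurableU.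

(* Edges have exactly two endpoints: no loops, and no multiple edges since the
   edges form a set. *)
Definition simple_graph (n : nat) (G : {set {set 'I_n}}) : bool :=
  [forall e in G, #|e : {set 'I_n}| == 2%N].

Definition degree (n : nat) (G : {set {set 'I_n}}) (v : 'I_n) : nat :=
  #|[set e in G | v \in (e : {set 'I_n})]%SET|.

Definition regular_graphs (n d : nat) : {set graph n} :=
  [set G : graph n | simple_graph G && [forall v, degree G v == d]]%SET.

(* The edges of the closed walk v_1, v_2, ..., v_k, v_1, for s = v_1 ... v_k. *)
Definition closed_walk_edges (n : nat) (s : seq 'I_n) : {set {set 'I_n}} :=
  [set [set v; next s v]%SET | v in s]%SET.

(* The bound k <= n only serves to make the quantification finite: it follows
   from the absence of repetitions. *)
Definition is_cycle (n : nat) (a : {set {set 'I_n}}) : bool :=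
  [exists k : 'I_n.+1, [exists s : k.-tuple 'I_n,
    [&& (3 <= k)%N, uniq s & a == closed_walk_edges s]]].

(* Being a set of edges, a cycle a has length #|a|. *)
Definition cycles_upto (n r : nat) : {set {set {set 'I_n}}} :=
  [set a : {set {set 'I_n}} | is_cycle a && (#|a| <= r)%N]%SET.

Definition cycle_index (n r : nat) : finType :=
  {a : {set {set 'I_n}} | a \in cycles_upto n r}.

(* The countable space N^I; its product sigma-algebra is the discrete one. *)
Definition count_vector (I : finType) : Type := {ffun I -> nat}.

HB.instance Definition _ (I : finType) := Countable.on (count_vector I).
HB.instance Definition _ (I : finType) :=
  isPointed.Build (count_vector I) [ffun=> 0%N].
HB.instance Definition _ (I : finType) :=
  @isMeasurable.Build default_measure_display (count_vector I)
    discrete_measurable discrete_measurable0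
    discrete_measurableC discrete_measurableU.

Section random_vector.
Context d (T : measurableType d) (R : realType) (P : probability T R).
Context (I : finType) (X : I -> {RV P >-> nat}).

Definition random_vector (w : T) : count_vector I := [ffun i => X i w].

Let measurable_random_vector : measurable_fun [set: T] random_vector.
Proof.
move=> _ B _; rewrite setTI.
have -> : random_vector @^-1` B =
    \bigcup_(v in B) \bigcap_(i in [set: I]) (X i @^-1` [set v i]).
  apply/seteqP; split=> [w Bw|w [v Bv vw]] /=.
    by exists (random_vector w) => // i _ /=; rewrite ffunE.
  suff -> : random_vector w = v by [].
  by apply/ffunP => i; rewrite ffunE; exact: vw.
rewrite bigcup_mkcond; apply: countable_bigcupT_measurable => [|v].
  exact: countableP.
case: ifP => // _; apply: fin_bigcap_measurable => [|i _].
  exact: finite_finset.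
by rewrite -[X in measurable X]setTI; apply: measurable_funPT.
Qed.

HB.instance Definition _ := isMeasurableFun.Build _ _ _ _
  random_vector measurable_random_vector.

End random_vector.

Section cycle_indicator.
Context (n : nat) (a : {set {set 'I_n}}).

Definition cycle_indicator (G : graph n) : nat := (a \subset G).

Let measurable_cycle_indicator : measurable_fun [set: graph n] cycle_indicator.
Proof. by []. Qed.

HB.instance Definition _ := isMeasurableFun.Build _ _ _ _
  cycle_indicator measurable_cycle_indicator.

End cycle_indicator.

Section probability_notions.
Context d (T : measurableType d) (R : realType).

Definition total_variation_dist (mu nu : probability T R) : \bar R :=
  ereal_sup [set `|mu A - nu A|%E | A in measurable].

Definition mutually_independent (P : probability T R) (I : finType)
    d' (T' : measurableType d') (X : I -> {RV P >-> T'}) : Prop :=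
  forall (J : {set I}) (B : I -> set T'), (forall i, measurable (B i)) ->
    P (\bigcap_(i in [set` J]) (X i @^-1` B i)) =
    (\prod_(i in J) fine (P (X i @^-1` B i)))%:E.

End probability_notions.

Definition uniform_on (n : nat) (R : realType) (S : {set graph n})
    (mu : probability (graph n) R) : Prop :=
  forall G : graph n,
    mu [set G] = (if G \in S then (#|S|%:R)^-1 else 0)%:E.

Definition is_poisson (R : realType) (rate : R)
    (mu : probability nat R) : Prop :=
  forall k : nat, mu [set k] = (poisson_pmf rate k)%:E.

(* Main.v *)
Require Import Defs.
From mathcomp Require Import all_boot all_order all_algebra.
From mathcomp Require Import all_classical all_reals all_analysis.
From mathcomp Require Import ring lra zify.

Set Implicit Arguments.
Unset Strict Implicit.
Unset Printing Implicit Defensive.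

Local Open Scope ring_scope.

(** Write [D = d - 1], let [lam_a = D^k / [n]_k] be the rate of a cycle [a] of
    length [k], and let [W G] be the set of the cycles of length at most [r]
    contained in the graph [G].  One may assume [n >= 1000 * D^(2r-1)], since
    otherwise the bound exceeds 1.

    The law of [W] is first compared with that of independent Bernoulli
    variables with odds [lam_a], by resampling the coordinates one after the
    other.  Resampling the coordinate [a] costs at most the largest value of
      [ | E(g(W); a in W) - lam_a * E(g(W); a notin W) | ]
    over the functions [g] with values in [-1, 1] that ignore [a]
    ([telescoping]).  The further passage from Bernoulli to Poisson variables
    costs the sum of the [lam_a^2] ([poisson_compare]).

    It remains to see that requiring a cycle [a] of length [k] to be present
    multiplies the weight of every event about the other short cycles by
    [lam_a], up to a relative error of order [k * D^(r-1) / n]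
    ([cycle_insertion]).  The cycle is inserted edge by edge.  Let [H] be the
    part already inserted and [uv] the next edge.  Replacing two edges [ua] and
    [vb] of [G], both outside [H], by [uv] and [ab] is, up to few exceptions, a
    bijection from the triples [(G, a, b)] with [H] inside [G] to the triples
    [(G', a, b)] with [H + uv] inside [G'] and [ab] an edge of [G'].  There are
    [(d - deg_H u) * (d - deg_H v)] choices of [(a, b)] on one side and [n * d]
    on the other, and the product of these ratios along the cycle is
    [D^k / n^k], which is close to [lam_a].

    The main point is that only a fraction of order [D^(r-1) / n] of the switches
    changes a short cycle other than [a].  A cycle that gets destroyed runs
    through [ua] or [vb]; one that gets created runs through [uv] or [ab].  In
    each case [G] contains a short path from [u] or from [v] whose last edge lies
    outside [H] and ends in [u], in [v] or on [H] ([clean_preserves]).  Such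
    paths are rare even conditionally on the presence of [H]: all but the last
    edge can be chosen in at most [2 * D^l] ways in every regular graph, and
    given that part of the graph the last edge is present with probability at
    most [2 * d / n], again by switching ([edge_bound], [sum_fresh_paths],
    [card_unclean]).

    Summing over the [k] edges of a cycle and over the at most [[n]_k / k] cycles
    of each length [k] ([card_cycles]) gives a total of order
    [D^(r-1) / n * (D + D^2 + ... + D^r)], hence of order [D^(2r-1) / n]. *)

(** * The two-edge switch *)

Section Switching.
Import mathcomp.boot.fintype mathcomp.boot.finset.
Import Order.TTheory GRing.Theory Num.Theory.
Local Open Scope nat_scope.
Local Open Scope set_scope.
Variable n : nat.
Implicit Types (G A B C H : {set {set 'I_n}}) (a b u v w x y : 'I_n).
Implicit Types p q : seq 'I_n.

Lemma degreeE G x : degree G x = \sum_(e in G) (x \in e).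
Proof.
rewrite /degree -sum1_card big_mkcond [RHS]big_mkcond /=.
by apply: eq_bigr => e _; rewrite !inE; case: (e \in G); case: (x \in e).
Qed.

Lemma simple_card2 G e : simple_graph G -> e \in G -> #|e| = 2.
Proof. by move=> /'forall_implyP sG eG; apply/eqP/sG. Qed.

Lemma simple_neq G x y : simple_graph G -> [set x; y] \in G -> x != y.
Proof. by move=> sG /(simple_card2 sG); rewrite cards2; case: (x != y). Qed.

Lemma simpleS A G : A \subset G -> simple_graph G -> simple_graph A.
Proof.
move=> /subsetP sAG sG; apply/'forall_implyP => e /sAG eG.
by rewrite (simple_card2 sG eG).
Qed.

Lemma set2_inj x y z : [set x; y] = [set x; z] -> y = z :> 'I_n.
Proof.
move=> E; have: y \in [set x; z] by rewrite -E !inE eqxx orbT.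
rewrite !inE => /orP[/eqP yx|/eqP //]; have: z \in [set x; y] by rewrite E !inE eqxx orbT.
by rewrite !inE yx orbb => /eqP.
Qed.

Definition nbr G x := [set y | [set x; y] \in G].

Lemma in_nbr G x y : (y \in nbr G x) = ([set x; y] \in G).
Proof. by rewrite inE. Qed.

Lemma card_nbr G x : simple_graph G -> #|nbr G x| = degree G x.
Proof.
move=> sG; rewrite /degree -(card_in_imset (f := fun y => [set x; y])); last first.
  by move=> y z _ _; exact: set2_inj.
congr #|pred_of_set _|; apply/setP => e; rewrite inE; apply/imsetP/andP.
  by move=> [y]; rewrite inE => yG ->; rewrite yG !inE eqxx.
move=> [eG xe]; have /eqP := simple_card2 sG eG.
move=> /cards2P[y [z [yz E]]]; rewrite {}E in xe eG *; move: xe; rewrite !inE => /orP[]/eqP->.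
  by exists z; rewrite ?inE.
by exists y; rewrite ?inE setUC.
Qed.

Lemma degreeD G A x : A \subset G -> degree (G :\: A) x = degree G x - degree A x.
Proof.
move=> sAG; rewrite !degreeE [X in X - _](big_setID A) /= (setIidPr sAG).
by rewrite addnC addnK.
Qed.

Definition swap G (e1 e2 f1 f2 : {set 'I_n}) := (G :\: [set e1; e2]) :|: [set f1; f2].

Lemma swapK G e1 e2 f1 f2 : e1 \in G -> e2 \in G -> f1 \notin G -> f2 \notin G ->
  swap (swap G e1 e2 f1 f2) f1 f2 e1 e2 = G.
Proof.
move=> e1G e2G /negPf f1G /negPf f2G; apply/setP => e; rewrite !inE.
have [->|ne1] := eqVneq e e1; first by rewrite orbT e1G.
have [->|ne2] := eqVneq e e2; first by rewrite /= orbT e2G.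
have [->|nf1] := eqVneq e f1; first by rewrite /= f1G; case: (f1 == f2).
have [->|nf2] := eqVneq e f2; first by rewrite /= f2G.
by rewrite /= !orbF.
Qed.

Lemma swap_degree G e1 e2 f1 f2 x : e1 != e2 -> f1 != f2 ->
  e1 \in G -> e2 \in G -> f1 \notin G -> f2 \notin G ->
  (x \in e1) + (x \in e2) = (x \in f1) + (x \in f2) ->
  degree (swap G e1 e2 f1 f2) x = degree G x.
Proof.
move=> ne nf e1G e2G f1G f2G E.
have s2 : [set e1; e2] \subset G by rewrite subUset !sub1set e1G e2G.
rewrite !degreeE (big_setID [set f1; f2]) [RHS](big_setID [set e1; e2]) /=.
rewrite (setIidPr s2) (setIidPr (subsetUr _ _)) /swap setDUl setDv setU0.
have -> : G :\: [set e1; e2] :\: [set f1; f2] = G :\: [set e1; e2].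
  apply/setP => e; rewrite !inE; have [->|] := eqVneq e f1.
    by rewrite (negPf f1G) !andbF.
  by have [->|] := eqVneq e f2; rewrite ?(negPf f2G) ?andbF.
congr (_ + _).
by rewrite !big_setU1 ?inE //= !big_set1 E.
Qed.

Variable d : nat.
Definition regular_over A := [set G in regular_graphs n d | A \subset G].

Lemma in_regular_over A G : (G \in regular_over A) = (G \in regular_graphs n d) && (A \subset G).
Proof. by rewrite inE. Qed.

Lemma regular_over_simple A G : G \in regular_over A -> simple_graph G.
Proof. by rewrite !inE => /andP[/andP[]]. Qed.
Lemma regular_over_degree A G x : G \in regular_over A -> degree G x = d.
Proof. by rewrite !inE => /andP[/andP[_ /forallP/(_ x)/eqP]]. Qed.
Lemma regular_over_sub A G : G \in regular_over A -> A \subset G.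
Proof. by rewrite inE => /andP[]. Qed.

Notation triple := (({set {set 'I_n}} * ('I_n * 'I_n))%type).

Section OneSwitch.
Variables (u v : 'I_n) (A : {set {set 'I_n}}).
Hypothesis uv : u != v.
Hypothesis uvA : [set u; v] \notin A.

Definition lpairs G := setX (nbr (G :\: A) u) (nbr (G :\: A) v).
Definition rpairs G := [set ab | [set ab.1; ab.2] \in G].
Definition ltriples : {set triple} := [set t | (t.1 \in regular_over A) && (t.2 \in lpairs t.1)].
Definition rtriples : {set triple} :=
  [set t | (t.1 \in regular_over ([set u; v] |: A)) && (t.2 \in rpairs t.1)].

(** Outside these side conditions the switch fails to produce a simple graph:
    [uv] or [ab] would be a loop or an edge that is already there.  That [ua] and
    [vb] lie outside [A] is part of [ltriples], so the switch keeps [A]. *)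
Definition lvalid : {set triple} := [set t in ltriples |
  [&& [set u; v] \notin t.1, t.2.1 != t.2.2 & [set t.2.1; t.2.2] \notin t.1]].
(** The outcomes of the switches in [lvalid]. *)
Definition rvalid : {set triple} := [set t in rtriples |
  [&& [set t.2.1; t.2.2] \notin [set u; v] |: A, t.2.1 != u, t.2.2 != v,
   [set u; t.2.1] \notin t.1 & [set v; t.2.2] \notin t.1]].

Definition fwd (t : triple) : triple :=
  (swap t.1 [set u; t.2.1] [set v; t.2.2] [set u; v] [set t.2.1; t.2.2], t.2).
Definition bwd (t : triple) : triple :=
  (swap t.1 [set u; v] [set t.2.1; t.2.2] [set u; t.2.1] [set v; t.2.2], t.2).

(** Every vertex lies in as many of the new edges as of the old ones, so all
    degrees are kept. *)
Lemma swap_regular G (e1 e2 f1 f2 : {set 'I_n}) B C : G \in regular_over B ->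
  e1 != e2 -> f1 != f2 -> #|f1| = 2 -> #|f2| = 2 ->
  e1 \in G -> e2 \in G -> f1 \notin G -> f2 \notin G ->
  (forall x, (x \in e1) + (x \in e2) = (x \in f1) + (x \in f2)) ->
  C \subset swap G e1 e2 f1 f2 ->
  swap G e1 e2 f1 f2 \in regular_over C.
Proof.
move=> GB ne nf c1 c2 e1G e2G f1G f2G E sC.
rewrite !inE sC andbT; apply/andP; split.
  apply/'forall_implyP => e; rewrite !inE => /orP[/andP[_ eG]|/orP[]/eqP->].
  - by rewrite (simple_card2 (regular_over_simple GB)).
  - by rewrite c1.
  - by rewrite c2.
by apply/forallP => x; rewrite swap_degree // (regular_over_degree _ GB).
Qed.

Lemma in_set2_sum x y z : y != z -> ((x \in [set y; z]) : nat) = (x == y) + (x == z).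
Proof. by move=> yz; rewrite !inE; case: (eqVneq x y) => [->|]; rewrite ?(negPf yz). Qed.

Lemma set2_neq x y z w : x != z -> x != w -> [set x; y] != [set z; w] :> {set 'I_n}.
Proof.
move=> xz xw; apply/eqP => E; have: x \in [set z; w] by rewrite -E !inE eqxx.
by rewrite !inE (negPf xz) (negPf xw).
Qed.

Lemma rvalidE G a b : ((G, (a, b)) \in rvalid) =
  [&& G \in regular_over ([set u; v] |: A), [set a; b] \in G, [set a; b] \notin [set u; v] |: A,
      a != u, b != v, [set u; a] \notin G & [set v; b] \notin G].
Proof.
rewrite inE [(_, _) \in rtriples]inE /= -andbA.
by rewrite [_ \in rpairs _]inE.
Qed.

Lemma lvalidE G a b : ((G, (a, b)) \in lvalid) =
  [&& G \in regular_over A, [set u; a] \in G :\: A, [set v; b] \in G :\: A,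
      [set u; v] \notin G, a != b & [set a; b] \notin G].
Proof.
rewrite inE [(_, _) \in ltriples]inE /= -andbA.
by rewrite in_setX /= !in_nbr -andbA.
Qed.

Lemma lvalidP G a b : (G, (a, b)) \in lvalid ->
  [/\ G \in regular_over A, [set u; a] \in G, [set v; b] \in G,
      [/\ [set u; v] \notin G, [set a; b] \notin G, [set u; a] \notin A & [set v; b] \notin A] &
      [/\ u != a, v != b, a != b, a != v & b != u]].
Proof.
rewrite lvalidE 2!in_setD => /and5P[GR /andP[uaA uaG] /andP[vbA vbG] uvG /andP[ab abG]].
have sG := regular_over_simple GR.
have [ua vb] := (simple_neq sG uaG, simple_neq sG vbG).
split => //; split => //; apply: contraNneq uvG => <- //.
by rewrite setUC.
Qed.

Lemma fwd_valid t : t \in lvalid -> fwd t \in rvalid.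
Proof.
case: t => G [a b] /lvalidP[GR uaG vbG [uvG abG uaA vbA] [ua vb ab av bu]].
have sub : [set u; v] |: A \subset swap G [set u; a] [set v; b] [set u; v] [set a; b].
  apply/subsetP => e; rewrite !inE => /orP[->|eA]; first by rewrite orbT.
  have eG := subsetP (regular_over_sub GR) _ eA; rewrite eG andbT.
  by rewrite negb_or; apply/orP; left; apply/andP; split; apply: contraTneq eA => ->.
have R : (fwd (G, (a, b))).1 \in regular_over ([set u; v] |: A).
  rewrite /fwd /=; apply: (swap_regular GR) => //; rewrite ?cards2 ?uv ?ab //.
  - by rewrite set2_neq // eq_sym.
  - by rewrite set2_neq // eq_sym.
  - by move=> x; rewrite !in_set2_sum // addnACA.
have a_u : a != u by rewrite eq_sym.
have abA := contra (subsetP (regular_over_sub GR) [set a; b]) abG.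
have abuv : [set a; b] != [set u; v] by rewrite set2_neq.
have b_v : b != v by rewrite eq_sym.
have uab : [set u; a] != [set a; b] by rewrite set2_neq // eq_sym.
have uauv : [set u; a] != [set u; v] by rewrite ![[set u; _]]setUC set2_neq.
have vbuv : [set v; b] != [set u; v] by rewrite setUC set2_neq.
have vbab : [set v; b] != [set a; b] by rewrite set2_neq // eq_sym.
rewrite rvalidE R a_u b_v !inE !eqxx /=.
by rewrite (negPf uauv) (negPf uab) (negPf vbuv) (negPf vbab) (negPf abuv) (negPf abA) ?orbT.
Qed.

Lemma rvalidP G a b : (G, (a, b)) \in rvalid ->
  [/\ G \in regular_over ([set u; v] |: A), [set u; v] \in G, [set a; b] \in G,
      [/\ [set u; a] \notin G, [set v; b] \notin G, [set a; b] \notin A & [set a; b] != [set u; v]] &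
      [/\ u != a, v != b, a != b, a != v & b != u]].
Proof.
rewrite rvalidE [_ \in _ |: _]in_setU1 negb_or => /and5P[GR abG /andP[abuv abA] au].
move=> /and3P[bv uaG vbG].
have uvG : [set u; v] \in G by apply: (subsetP (regular_over_sub GR)); rewrite !inE eqxx.
have ab := simple_neq (regular_over_simple GR) abG.
have av : a != v by apply: contraNneq uaG => ->.
have bu : b != u by apply: contraNneq vbG => ->; rewrite setUC.
by split => //; split => //; rewrite eq_sym.
Qed.

Lemma bwd_valid t : t \in rvalid -> bwd t \in lvalid.
Proof.
case: t => G [a b] /rvalidP[GR uvG abG [uaG vbG abA abuv] [ua vb ab av bu]].
have subA : A \subset G by apply: subset_trans (regular_over_sub GR); apply: subsetUr.
have sub : A \subset swap G [set u; v] [set a; b] [set u; a] [set v; b].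
  apply/subsetP => e eA; rewrite !inE.
  have eG := subsetP subA _ eA; rewrite eG andbT.
  by rewrite negb_or; apply/orP; left; apply/andP; split; apply: contraTneq eA => ->.
have R : (bwd (G, (a, b))).1 \in regular_over A.
  rewrite /bwd /=; apply: (swap_regular GR) => //; rewrite ?cards2 ?ua ?vb //.
  - by rewrite eq_sym.
  - by rewrite set2_neq // eq_sym.
  - by move=> x; rewrite !in_set2_sum // addnACA.
have uaA := contra (subsetP subA _) uaG; have vbA := contra (subsetP subA _) vbG.
have b_v : b != v by rewrite eq_sym.
have a_u : a != u by rewrite eq_sym.
have uvua : [set u; v] != [set u; a] by rewrite ![[set u; _]]setUC set2_neq 1?eq_sym.
have uvvb : [set u; v] != [set v; b] by rewrite set2_neq // eq_sym.
have abua : [set a; b] != [set u; a] by rewrite setUC set2_neq // eq_sym.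
have abvb : [set a; b] != [set v; b] by rewrite set2_neq.
rewrite lvalidE R ab !inE !eqxx /= (negPf uaA) (negPf vbA).
by rewrite (negPf uvua) (negPf uvvb) (negPf abua) (negPf abvb) ?orbT.
Qed.

End OneSwitch.
End Switching.

(** * Counting switchings *)

Section SwitchCounts.
Import mathcomp.boot.fintype mathcomp.boot.finset.
Import Order.TTheory GRing.Theory Num.Theory.
Local Open Scope nat_scope.
Local Open Scope set_scope.
Variables (n d : nat).
Implicit Types (G A B C H : {set {set 'I_n}}) (a b u v w x y : 'I_n).

Notation triple := (({set {set 'I_n}} * ('I_n * 'I_n))%type).

Lemma big_triples (S : Type) (idx : S) (op : Monoid.com_law idx)
    (P : {set {set {set 'I_n}}}) (Q : {set {set 'I_n}} -> {set 'I_n * 'I_n}) (F : triple -> S) :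
  \big[op/idx]_(t in [set t : triple | (t.1 \in P) && (t.2 \in Q t.1)]) F t =
  \big[op/idx]_(G in P) \big[op/idx]_(ab in Q G) F (G, ab).
Proof.
rewrite [RHS]pair_big_dep /=; apply: eq_big => [[G ab]|[G ab] _] //=.
by rewrite inE.
Qed.

Lemma sum_degree A : simple_graph A -> \sum_x degree A x = 2 * #|A|.
Proof.
move=> sA; under eq_bigr do rewrite degreeE.
rewrite exchange_big /= mulnC -sum_nat_const; apply: eq_bigr => e eA.
rewrite -(simple_card2 sA eA) -sum1_card [RHS]big_mkcond.
by apply: eq_bigr => x _; case: (x \in e).
Qed.

Lemma card_rpairs A : simple_graph A -> #|rpairs A| = 2 * #|A|.
Proof.
move=> sA; rewrite -sum_degree // -sum1_card (eq_bigl (fun ab => ab.2 \in nbr A ab.1)).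
  rewrite -(pair_big_dep predT (fun a b => b \in nbr A a) (fun _ _ => 1)) /=.
  by apply: eq_bigr => x _; rewrite sum1_card card_nbr.
by move=> [a b]; rewrite !inE.
Qed.

Section OneSwitch.
Variables (u v : 'I_n) (A : {set {set 'I_n}}).
Hypothesis uv : u != v.
Hypothesis uvA : [set u; v] \notin A.

Let fwdt (t : triple) := fwd u v t.
Let bwdt (t : triple) := bwd u v t.

Lemma fwdK : {in lvalid d u v A, cancel fwdt bwdt}.
Proof.
move=> [G [a b]] /lvalidP[GR uaG vbG [uvG abG _ _] _].
by rewrite /bwdt /fwdt /bwd /fwd /= swapK.
Qed.

Lemma bwdK : {in rvalid d u v A, cancel bwdt fwdt}.
Proof.
move=> [G [a b]] /rvalidP[GR uaG vbG [uvG abG _ _] _].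
by rewrite /bwdt /fwdt /bwd /fwd /= swapK.
Qed.

Lemma card_lvalid : #|lvalid d u v A| = #|rvalid d u v A|.
Proof.
apply/eqP; rewrite eqn_leq; apply/andP; split.
  rewrite -(card_in_imset (can_in_inj fwdK)); apply/subset_leq_card/subsetP.
  by move=> _ /imsetP[t tl ->]; exact: fwd_valid.
rewrite -(card_in_imset (can_in_inj bwdK)); apply/subset_leq_card/subsetP.
by move=> _ /imsetP[t tl ->]; exact: bwd_valid.
Qed.

Lemma card_lpairs G : G \in regular_over d A ->
  #|lpairs u v A G| = (d - degree A u) * (d - degree A v).
Proof.
move=> GR; have sAG := regular_over_sub GR.
have sD := simpleS (subsetDl G A) (regular_over_simple GR).
by rewrite cardsX !card_nbr // !degreeD // !(regular_over_degree _ GR).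
Qed.

Lemma card_ltriples :
  #|ltriples d u v A| = (d - degree A u) * (d - degree A v) * #|regular_over d A|.
Proof.
rewrite -sum1_card big_triples mulnC -sum_nat_const; apply: eq_bigr => G GR.
by rewrite sum1_card card_lpairs.
Qed.

Lemma card_rtriples : #|rtriples d u v A| = n * d * #|regular_over d ([set u; v] |: A)|.
Proof.
rewrite -sum1_card big_triples mulnC -sum_nat_const; apply: eq_bigr => G GR.
rewrite sum1_card card_rpairs ?(regular_over_simple GR) // -sum_degree ?(regular_over_simple GR) //.
under eq_bigr do rewrite (regular_over_degree _ GR).
by rewrite sum_nat_const card_ord.
Qed.

(** An edge [ab] cannot be switched back only if it belongs to [A + uv], starts
    at [u], ends at [v], or has its first end adjacent to [u] or its second end
    adjacent to [v].  The last two leave at most [d * d] ordered pairs each. *)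
Lemma card_rinvalid :
  #|rtriples d u v A :\: rvalid d u v A| <=
    (2 * #|A|.+1 + 2 * d + 2 * (d * d)) * #|regular_over d ([set u; v] |: A)|.
Proof.
set N := regular_over d _.
pose inv G := rpairs ([set u; v] |: A) :|: setX [set u] (nbr G u) :|:
  setX (nbr G v) [set v] :|: [set ab in rpairs G | ab.1 \in nbr G u] :|:
  [set ab in rpairs G | ab.2 \in nbr G v].
pose X := [set t : triple | (t.1 \in N) && (t.2 \in inv t.1)].
have sub : rtriples d u v A :\: rvalid d u v A \subset X.
  apply/subsetP => [[G [a b]]]; rewrite in_setD rvalidE !in_set /= => /andP[nv /andP[GN abG]].
  rewrite ?in_set /= GN /= abG /=; apply: contraNT nv; rewrite -/N GN abG /=.
  rewrite !negb_or -!andbA => /and5P[-> -> h1 h2 /andP[h3 h4]].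
  rewrite h3 h4 !andbT /=; apply/andP; split.
    by apply: contraNneq h1 => ea; rewrite ea in_set1 eqxx -ea abG.
  by apply: contraNneq h2 => ea; rewrite ea in_set1 eqxx -ea andbT setUC abG.
apply: leq_trans (subset_leq_card sub) _.
rewrite -sum1_card big_triples mulnC -sum_nat_const; apply: leq_sum => G GR.
have sG := regular_over_simple GR; have dG x := regular_over_degree x GR.
have sub' : [set u; v] |: A \subset G := regular_over_sub GR.
rewrite sum1_card /inv.
have c1 : #|rpairs ([set u; v] |: A)| <= 2 * #|A|.+1.
  by rewrite card_rpairs ?(simpleS sub') // leq_mul2l /= cardsU1; case: (_ \notin _).
have c2 : #|setX [set u] (nbr G u)| = d by rewrite cardsX cards1 card_nbr // dG mul1n.
have c3 : #|setX (nbr G v) [set v]| = d by rewrite cardsX cards1 card_nbr // dG muln1.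
have c4 w : #|[set ab in rpairs G | ab.1 \in nbr G w]| = d * d.
  rewrite -sum1_card (eq_bigl (fun ab => (ab.1 \in nbr G w) && (ab.2 \in nbr G ab.1))).
    rewrite -(pair_big_dep (mem (nbr G w)) (fun a b => b \in nbr G a) (fun _ _ => 1)) /=.
    under eq_bigr do rewrite sum1_card card_nbr // dG.
    by rewrite sum_nat_const card_nbr // dG.
  by move=> [a b]; rewrite !inE andbC.
have c5 : #|[set ab in rpairs G | ab.2 \in nbr G v]| = d * d.
  pose s (ab : 'I_n * 'I_n) := (ab.2, ab.1).
  have sK : involutive s by case.
  rewrite -(c4 v) -(card_preimset _ (inv_inj sK)).
  by apply: eq_card => [[a b]]; rewrite !inE /= setUC.
have -> : 2 * #|A|.+1 + 2 * d + 2 * (d * d) = 2 * #|A|.+1 + d + d + d * d + d * d by ring.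
have cU (S T : {set 'I_n * 'I_n}) : #|S :|: T| <= #|S| + #|T| by apply: leq_card_setU.
apply: leq_trans (cU _ _) _; rewrite c5 leq_add2r.
apply: leq_trans (cU _ _) _; rewrite c4 leq_add2r.
apply: leq_trans (cU _ _) _; rewrite c3 leq_add2r.
by apply: leq_trans (cU _ _) _; rewrite c2 leq_add2r.
Qed.

End OneSwitch.
End SwitchCounts.

(** * Edge probabilities and the switching identity *)

Section SwitchBounds.
Import mathcomp.boot.fintype mathcomp.boot.finset.
Import Order.TTheory GRing.Theory Num.Theory.
Local Open Scope nat_scope.
Local Open Scope set_scope.
Variables (n d : nat).
Implicit Types (G A B C H : {set {set 'I_n}}) (a b u v w x y : 'I_n).

Notation triple := (({set {set 'I_n}} * ('I_n * 'I_n))%type).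

Definition switch_loss A := 2 * #|A|.+1 + 2 * d + 2 * (d * d).

Lemma rvalid_sub u v A : rvalid d u v A \subset rtriples d u v A.
Proof. by apply/subsetP => t; rewrite inE => /andP[]. Qed.

Lemma lvalid_sub u v A : lvalid d u v A \subset ltriples d u v A.
Proof. by apply/subsetP => t; rewrite inE => /andP[]. Qed.

(** The valid triples of both sides are equinumerous, so the right-hand ones
    exceed the left-hand ones at most by the invalid ones. *)
Lemma rtriples_le u v A : u != v -> [set u; v] \notin A ->
  n * d * #|regular_over d ([set u; v] |: A)| <=
    (d - degree A u) * (d - degree A v) * #|regular_over d A|
      + switch_loss A * #|regular_over d ([set u; v] |: A)|.
Proof.
move=> uv uvA; rewrite -card_rtriples // -card_ltriples //.
rewrite -(cardsID (rvalid d u v A)) (setIidPr (rvalid_sub u v A)).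
apply: leq_add; last exact: card_rinvalid.
by rewrite -card_lvalid // subset_leq_card // lvalid_sub.
Qed.

(** Conditionally on [A], an edge is present with probability at most
    [2 * d / n]: when the invalid triples are at most half of the right-hand side
    of [rtriples_le] they can be absorbed by its left-hand side. *)
Lemma edge_bound u v A : 0 < d -> [set u; v] \notin A ->
  2 * switch_loss A <= n * d ->
  n * #|regular_over d ([set u; v] |: A)| <= 2 * d * #|regular_over d A|.
Proof.
move=> d0 uvA small; have [uv|uv] := eqVneq u v.
  suff -> : regular_over d ([set u; v] |: A) = set0 by rewrite cards0 muln0.
  apply/setP => G; rewrite in_set0; apply/negP => GR.
  have /(simple_neq (regular_over_simple GR)) : [set u; v] \in G.
    by apply: (subsetP (regular_over_sub GR)); rewrite setU11.
  by rewrite uv eqxx.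
rewrite -(leq_pmul2r d0) -mulnA [_ * d]mulnC mulnA.
have := rtriples_le uv uvA.
set N := #|regular_over d A|; set N' := #|regular_over d _|; set s := switch_loss A in small *.
have : (d - degree A u) * (d - degree A v) <= d * d by rewrite leq_mul ?leq_subr.
move: (_ - _) => x /(leq_mul (leqnn N)) le1 le2.
have le3 := leq_mul small (leqnn N').
move: le1 le2 le3; clear; nia.
Qed.

(** On [S] the terms of both sums cancel along the switch, and each remaining
    term is at most 1 in absolute value.  The valid right-hand triples outside the
    image of [S] are as many as the valid left-hand ones outside [S], whence the
    factor 2. *)
Lemma switch_sum_diff (R : realFieldType) u v A (h : {set {set 'I_n}} -> R)
    (S : {set triple}) : u != v -> [set u; v] \notin A ->
  S \subset lvalid d u v A ->
  (forall G, `|h G| <= 1)%R ->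
  {in S, forall t, h (fwd u v t).1 = h t.1} ->
  (`|\sum_(t in ltriples d u v A) h t.1 - \sum_(t in rtriples d u v A) h t.1|
     <= (2 * #|ltriples d u v A :\: S| + #|rtriples d u v A :\: rvalid d u v A|)%:R)%R.
Proof.
move=> uv uvA SV h1 hS; set L := ltriples _ _ _ _; set T := rtriples _ _ _ _.
pose F := [set fwd u v t | t in S].
have injS : {in S &, injective (fun t : triple => fwd u v t)}.
  by move=> s t /(subsetP SV) sS /(subsetP SV) tS; apply: (can_in_inj (fwdK (d := d) (A := A))).
have FV : F \subset rvalid d u v A.
  by apply/subsetP => _ /imsetP[t /(subsetP SV) tS ->]; apply: fwd_valid.
have FT : F \subset T := subset_trans FV (rvalid_sub u v A).
have SL : S \subset L := subset_trans SV (lvalid_sub u v A).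
rewrite [X in (X - _)%R](big_setID S) [X in (_ - X)%R](big_setID F) /=.
rewrite (setIidPr SL) (setIidPr FT) [X in (_ - (X + _))%R]big_imset //=.
rewrite [X in (_ - (X + _))%R](eq_bigr (fun t => h t.1)) //.
rewrite opprD addrACA subrr add0r.
have bound (X : {set triple}) : (`|\sum_(t in X) h t.1| <= #|X|%:R :> R)%R.
  apply: le_trans (ler_norm_sum _ _ _) _.
  by apply: le_trans (ler_sum _ (fun i _ => h1 i.1)) _; rewrite sumr_const.
apply: le_trans (ler_normB _ _) _.
apply: le_trans (lerD (bound _) (bound _)) _; rewrite -natrD ler_nat.
rewrite mul2n -addnn -addnA leq_add2l.
have cF : #|F| = #|S| by rewrite card_in_imset.
rewrite !cardsD (setIidPr FT) (setIidPr SL) (setIidPr (rvalid_sub u v A)) cF.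
have := subset_leq_card SV; have := card_lvalid d uv uvA.
have := subset_leq_card (rvalid_sub u v A); have := subset_leq_card (lvalid_sub u v A).
rewrite -/L -/T; lia.
Qed.

End SwitchBounds.

(** * Paths and cycles *)

Section Paths.
Import mathcomp.boot.fintype mathcomp.boot.finset.
Import Order.TTheory GRing.Theory Num.Theory.
Local Open Scope nat_scope.
Local Open Scope set_scope.
Variables (n d : nat).
Implicit Types (G A B C H : {set {set 'I_n}}) (a b u v w x y z : 'I_n) (e : {set 'I_n}).
Implicit Types p q s : seq 'I_n.

Fixpoint path_edges x p : {set {set 'I_n}} :=
  if p is y :: q then [set x; y] |: path_edges y q else set0.

Lemma path_edges_cat x p q :
  path_edges x (p ++ q) = path_edges x p :|: path_edges (last x p) q.
Proof. by elim: p x => [|y p IH] x /=; rewrite ?set0U // IH setUA. Qed.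

Lemma path_edges_rcons x p y :
  path_edges x (rcons p y) = [set last x p; y] |: path_edges x p.
Proof. by rewrite -cats1 path_edges_cat /= setU0 setUC. Qed.

Lemma path_edges_mem x p e z : e \in path_edges x p -> z \in e -> z \in x :: p.
Proof.
elim: p x => [|y p IH] x /=; first by rewrite inE.
rewrite inE => /orP[|ep ze]; last by rewrite inE IH ?orbT.
by rewrite inE => /eqP->; rewrite !inE => /orP[]->; rewrite ?orbT.
Qed.

Lemma path_edges_notin x p y z : y \notin x :: p -> [set y; z] \notin path_edges x p.
Proof. by apply: contra => /path_edges_mem; apply; rewrite !inE eqxx. Qed.

Lemma card_path_edges x p : uniq (x :: p) -> #|path_edges x p| = size p.
Proof.
elim: p x => [|y p IH] x; first by rewrite cards0.
rewrite cons_uniq => /andP[xp up].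
by rewrite /= cardsU1 path_edges_notin // IH.
Qed.

Lemma closing_edge_notin x p : uniq (x :: p) -> 1 < size p ->
  [set last x p; x] \notin path_edges x p.
Proof.
case: p => [//|y p]; rewrite cons_uniq => /andP[xyp up] /= p1.
rewrite setUC in_setU1 negb_or path_edges_notin // andbT.
apply: contraTneq up => /set2_inj yE; case: p p1 yE {xyp} => //= z p _ <-.
by rewrite mem_last.
Qed.

Lemma last_rev_path x p : last (last x p) (rev (belast x p)) = x.
Proof. by case: p => //= y p; rewrite rev_cons last_rcons. Qed.

Lemma path_edges_rev x p :
  path_edges (last x p) (rev (belast x p)) = path_edges x p.
Proof.
elim: p x => [|y p IH] x //=.
by rewrite rev_cons path_edges_rcons IH last_rev_path [[set y; x]]setUC.
Qed.

Lemma rev_path x p : rev (x :: p) = last x p :: rev (belast x p).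
Proof. by rewrite lastI rev_rcons. Qed.

Lemma path_reverse x p y : uniq (x :: p) -> last x p = y ->
  exists q, [/\ uniq (y :: q), last y q = x, size q = size p &
    path_edges y q = path_edges x p].
Proof.
move=> up <-; exists (rev (belast x p)).
by rewrite -rev_path rev_uniq last_rev_path size_rev size_belast path_edges_rev.
Qed.

Lemma closed_walk_edgesE x p : uniq (x :: p) ->
  closed_walk_edges (x :: p) = [set last x p; x] |: path_edges x p.
Proof.
rewrite /closed_walk_edges /next.
have gen y0 q y : uniq (y :: q) ->
  [set [set w; next_at w y0 y q] | w in y :: q] = [set last y q; y0] |: path_edges y q.
  elim: q y => [|z q IH] y.
    move=> _; apply/setP => e; rewrite setU0 inE; apply/imsetP/eqP => [[w]|->].
      by rewrite inE => /eqP -> ->; rewrite /= eqxx.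
    by exists y; rewrite ?inE //= eqxx.
  rewrite cons_uniq => /andP[yq uq]; rewrite [last y _]/= [path_edges y _]/=.
  rewrite setUCA -IH //; apply/setP => e; rewrite in_setU1.
  apply/imsetP/orP => [[w]|[/eqP->|/imsetP[w wq ->]]].
  - rewrite inE => /orP[/eqP->|wq] ->; first by left; rewrite /= eqxx.
    right; apply/imsetP; exists w => //=; case: eqP => // wy.
    by rewrite -wy wq in yq.
  - by exists y; rewrite ?mem_head //= eqxx.
  - exists w; first by rewrite inE wq orbT.
    by rewrite /=; case: eqP => // wy; rewrite -wy wq in yq.
by move=> up; rewrite -gen.
Qed.

Lemma card_closed_walk_edges s : uniq s -> 2 < size s ->
  #|closed_walk_edges s| = size s.
Proof.
case: s => [//|x p] up p1.
by rewrite closed_walk_edgesE // cardsU1 closing_edge_notin // card_path_edges.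
Qed.

Lemma closed_walk_edges_rot k s : uniq s -> closed_walk_edges (rot k s) = closed_walk_edges s.
Proof.
move=> us; apply/setP => e; apply/imsetP/imsetP => -[w ws ->]; exists w.
- by rewrite mem_rot in ws.
- by rewrite next_rot.
- by rewrite mem_rot.
- by rewrite next_rot.
Qed.

Lemma closed_walk_edges_rev s : uniq s -> closed_walk_edges (rev s) = closed_walk_edges s.
Proof.
move=> us; apply/setP => e; apply/imsetP/imsetP => -[w ws ->].
  rewrite mem_rev in ws; exists (prev s w); first by rewrite mem_prev.
  by rewrite next_prev // next_rev // setUC.
exists (next s w); first by rewrite mem_rev mem_next.
by rewrite next_rev // prev_next // setUC.
Qed.

Lemma closed_walk_edges_from s x y : uniq s -> [set x; y] \in closed_walk_edges s ->
  exists2 p, uniq (x :: p) & [/\ last x p = y, size (x :: p) = size s &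
    closed_walk_edges s = closed_walk_edges (x :: p)].
Proof.
move=> us.
have main t : uniq t -> x \in t -> y = prev t x ->
  exists2 p, uniq (x :: p) & [/\ last x p = y, size (x :: p) = size t &
    closed_walk_edges t = closed_walk_edges (x :: p)].
  move=> ut xt yE; case: (rot_to xt) => i p E; exists p; first by rewrite -E rot_uniq.
  rewrite -E size_rot closed_walk_edges_rot //; split=> //.
  rewrite yE -(prev_rot i ut) E.
  have : uniq (x :: p) by rewrite -E rot_uniq.
  have pa q z : x \notin q -> prev_at x x z q = last z q.
    elim: q z => [|z' q IH] z /=; rewrite ?eqxx // inE negb_or.
    by move=> /andP[/negPf-> /IH].
  by rewrite cons_uniq => /andP[xp _]; rewrite /= pa.
case/imsetP => w ws E.
have wE : w \in [set x; y] by rewrite E set21.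
move: wE; rewrite !inE => /orP[]/eqP wE.
  have yE : y = next s x by rewrite wE in E; exact: set2_inj E.
  have [] := main (rev s); rewrite ?rev_uniq ?mem_rev -?wE // ?wE ?prev_rev //.
  by move=> p up; rewrite size_rev closed_walk_edges_rev //; exists p.
apply: main => //; last first.
  have -> : x = next s y by rewrite wE setUC in E; exact: set2_inj E.
  by rewrite prev_next.
have -> : x = next s y by rewrite wE setUC in E; exact: set2_inj E.
by rewrite mem_next -wE.
Qed.

(** Opening a cycle at one of its edges leaves a path between its ends; the
    orientation of the cycle can be chosen. *)
Lemma cycle_from A x y : is_cycle A -> [set x; y] \in A ->
  exists p, [/\ uniq (x :: p), last x p = y, 1 < size p, #|A| = (size p).+1 &
    A = [set y; x] |: path_edges x p].
Proof.
move=> /existsP[k /existsP[s /and3P[k3 us /eqP->]]] xyA.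
have [p up [lp sp ->]] := closed_walk_edges_from us xyA.
have p1 : 1 < size p by move: sp; rewrite size_tuple /= => sp; rewrite -sp in k3.
exists p; rewrite closed_walk_edgesE // lp; split=> //.
by rewrite cardsU1 -lp closing_edge_notin // card_path_edges.
Qed.

Lemma path_edges_split x p e : e \in path_edges x p ->
  exists p1 y p2, p = p1 ++ y :: p2 /\ e = [set last x p1; y].
Proof.
elim: p x => [|y p IH] x /=; first by rewrite inE.
rewrite in_setU1 => /orP[/eqP->|/IH[p1 [z [p2 [-> ->]]]]].
  by exists [::], y, p.
by exists (y :: p1), z, p2.
Qed.

(** In a path the neighbours of a vertex are its predecessor and its successor. *)
Lemma path_edges_step u x p (t : nat) y : uniq (x :: p) -> t < size (x :: p) ->
  [set y; nth u (x :: p) t] \in path_edges x p ->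
  y \in take t (x :: p) \/ (t.+1 < size (x :: p) /\ y = nth u (x :: p) t.+1).
Proof.
elim: p x t => [|z p IH] x t; first by rewrite inE.
rewrite cons_uniq => /andP[xp up] tl.
rewrite [path_edges _ _]/= in_setU1; case: t tl => [|t] tl.
  rewrite [nth _ _ 0]/= setUC => /orP[/eqP/set2_inj->|]; first by right.
  by rewrite (negPf (path_edges_notin _ xp)).
rewrite [nth _ _ t.+1]/= [take _ _]/=.
have wx : nth u (z :: p) t != x.
  by apply: contraNneq xp => <-; apply: mem_nth.
case/orP => [/eqP E|/(IH _ _ up tl)[yt|[h1 h2]]].
- left; have : y \in [set x; z] by rewrite -E set21.
  rewrite !inE => /orP[->//|/eqP yz].
  have : nth u (z :: p) t \in [set x; z] by rewrite -E set22.
  rewrite !inE (negPf wx) /= => /eqP wz; move: E; rewrite yz wz => /setP/(_ x).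
  by rewrite !inE eqxx -wz eq_sym (negPf wx).
- by left; rewrite inE yt orbT.
- by right.
Qed.

Lemma degree_path_notin x p z : z \notin x :: p -> degree (path_edges x p) z = 0.
Proof.
move=> zp; rewrite degreeE big1 // => e ep; apply/eqP; rewrite eqb0.
by apply: contra zp => /(path_edges_mem ep).
Qed.

Lemma degreeU1 A e z : e \notin A -> degree (e |: A) z = (z \in e) + degree A z.
Proof. by move=> eA; rewrite !degreeE big_setU1. Qed.

Lemma degree_path_head x p : uniq (x :: p) -> degree (path_edges x p) x = (p != [::]).
Proof.
case: p => [|y p]; first by rewrite degreeE big_set0.
rewrite cons_uniq => /andP[xp _] /=.
by rewrite degreeU1 ?path_edges_notin // set21 degree_path_notin.
Qed.

Lemma degree_path_last x p : uniq (x :: p) ->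
  degree (path_edges x p) (last x p) = (p != [::]).
Proof.
move=> up; rewrite -path_edges_rev degree_path_head -?rev_path ?rev_uniq //.
by rewrite -!size_eq0 size_rev size_belast.
Qed.

(** The non-backtracking walks with [l] steps from [u], where [w] is the vertex
    visited before [u]. *)
Fixpoint nb_paths G w u l : seq (seq 'I_n) :=
  if l is l'.+1 then [seq y :: p | y <- enum (nbr G u :\ w), p <- nb_paths G u y l']
  else [:: [::]].

Lemma size_nb_paths A G w u l : G \in regular_over d A -> w \in nbr G u ->
  size (nb_paths G w u l) <= d.-1 ^ l.
Proof.
move=> GR; elim: l w u => [|l IH] w u wu //=.
rewrite size_allpairs_dep sumnE big_map expnS.
have c : size (enum (nbr G u :\ w)) = d.-1.
  rewrite -cardE; have := cardsD1 w (nbr G u).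
  by rewrite wu card_nbr ?(regular_over_simple GR) // (regular_over_degree _ GR) => ->.
rewrite -[X in _ <= X * _]c -sum1_size big_distrl /= !big_seq; apply: leq_sum => y.
rewrite mem_enum !inE mul1n => /andP[_ uy]; apply: IH.
by rewrite inE setUC.
Qed.

Lemma mem_nb_paths G w u p : uniq [:: w, u & p] -> path_edges u p \subset G ->
  p \in nb_paths G w u (size p).
Proof.
elim: p w u => [|y p IH] w u //= /and4P[wp up yp uup] sG.
have [uyG sub] : [set u; y] \in G /\ path_edges y p \subset G.
  by move: sG; rewrite subUset sub1set => /andP.
apply/allpairsPdep; exists y, p; split=> //.
  rewrite mem_enum !inE uyG andbT.
  by move: wp; rewrite !inE !negb_or => /and3P[_ wy _]; rewrite eq_sym.
by apply: IH => //=; rewrite up yp uup.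
Qed.

(** The first step has [d] choices and each further one at most [d - 1].  The
    bound [d <= 2 * (d - 1)] makes the estimate uniform in [l], including 0. *)
Lemma card_paths A G u l : G \in regular_over d A -> 1 < d ->
  #|[set p : l.-tuple 'I_n | uniq (u :: p) && (path_edges u p \subset G)]| <= 2 * d.-1 ^ l.
Proof.
move=> GR d1.
pose s := if l is l'.+1 then [seq y :: p | y <- enum (nbr G u), p <- nb_paths G u y l']
          else [:: [::]].
have size_s : size s <= 2 * d.-1 ^ l.
  rewrite /s; case: l {s} => [//|l]; rewrite size_allpairs_dep sumnE big_map.
  have c : size (enum (nbr G u)) <= 2 * d.-1.
    by rewrite -cardE card_nbr ?(regular_over_simple GR) // (regular_over_degree _ GR); lia.
  rewrite expnS mulnA; apply: leq_trans (leq_mul c (leqnn _)).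
  rewrite -sum1_size big_distrl /= !big_seq; apply: leq_sum => y.
  rewrite mem_enum inE mul1n => uy; apply: (size_nb_paths _ GR).
  by rewrite inE setUC.
apply: leq_trans size_s.
set S := [set p | _]; rewrite cardE -(size_map val); apply: uniq_leq_size.
  by rewrite map_inj_uniq ?enum_uniq //; exact: val_inj.
move=> t /mapP[p]; rewrite mem_enum inE => /andP[up sub] ->.
move: up sub (size_tuple p); rewrite /s /=; move: (tval p) => {p} [|y q].
  by move=> _ _ /= <-; rewrite inE.
rewrite cons_uniq => /andP[uyq uq] /=; rewrite subUset sub1set => /andP[uyG sub] sz.
rewrite -sz; apply/allpairsPdep; exists y, q; split=> //.
  by rewrite mem_enum inE.
by apply: mem_nb_paths => //; rewrite /= uyq; exact: uq.
Qed.

End Paths.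

(** * Few switchings meet a short path *)

Section BadSwitchings.
Import mathcomp.boot.fintype mathcomp.boot.finset.
Import Order.TTheory GRing.Theory Num.Theory.
Local Open Scope nat_scope.
Local Open Scope set_scope.
Variables (n d : nat).
Hypothesis d1 : 2 < d.
Implicit Types (G A B C H : {set {set 'I_n}}) (a b u v w x y z : 'I_n) (e : {set 'I_n}).
Implicit Types p q s hs : seq 'I_n.
Notation triple := (({set {set 'I_n}} * ('I_n * 'I_n))%type).
Local Notation D := d.-1.

(** The step to [x] uses an edge that is neither in [H] nor on the path, so
    [edge_bound] applies to it conditionally on [H] and the path.  The end [x] may
    be [u] itself, which closes a cycle. *)
Definition fresh_path H G u x p :=
  [&& uniq (u :: p), path_edges u p \subset G, [set last u p; x] \in G,
      [set last u p; x] \notin H & [set last u p; x] \notin path_edges u p].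

Definition fresh_paths H G u x l := [set p : l.-tuple 'I_n | fresh_path H G u x p].

(** Exchange the sums over graphs and paths.  For a fixed path, dropping the last
    edge from the requirements costs a factor [2 * d / n]; then each graph
    contains at most [2 * D^l] paths. *)
Lemma sum_fresh_paths H u x l :
  (forall A, #|A| <= #|H| + l -> 2 * switch_loss d A <= n * d) ->
  n * \sum_(G in regular_over d H) #|fresh_paths H G u x l| <= 8 * D ^ l.+1 * #|regular_over d H|.
Proof.
move=> small.
pose e (p : l.-tuple 'I_n) := [set last u p; x].
pose ok (p : l.-tuple 'I_n) :=
  [&& uniq (u :: p), e p \notin H & e p \notin path_edges u p].
have -> : \sum_(G in regular_over d H) #|fresh_paths H G u x l| =
    \sum_(p | ok p) #|regular_over d (e p |: (path_edges u p :|: H))|.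
  under eq_bigr => G GH do rewrite -sum1_card big_mkcond /=.
  rewrite exchange_big /= [RHS]big_mkcond; apply: eq_bigr => p _.
  rewrite -big_mkcondr /=; case: ifP => [okp|nok]; last first.
    rewrite big_pred0 // => G; apply: contraFF nok.
    by rewrite [p \in _]inE => /andP[_ /and5P[h1 _ _ h2 h3]]; apply/and3P.
  rewrite -sum1_card; apply: eq_bigl => G.
  move: okp => /and3P[h1 h2 h3]; rewrite [p \in _]inE /fresh_path h1 h2 h3 /= !in_regular_over.
  rewrite !subUset sub1set /e andbT -!andbA; congr (_ && _).
  by case: (H \subset G); case: (path_edges u p \subset G); case: (_ \in G).
rewrite big_distrr /=.
have le1 (p : l.-tuple 'I_n) : ok p -> n * #|regular_over d (e p |: (path_edges u p :|: H))| <=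
    2 * d * #|regular_over d (path_edges u p :|: H)|.
  move=> /and3P[h1 h2 h3]; apply: edge_bound; first by lia.
    by rewrite in_setU negb_or h3.
  apply: small; apply: leq_trans (leq_card_setU _ _) _.
  by rewrite card_path_edges // size_tuple addnC.
apply: leq_trans (leq_sum _ le1) _.
rewrite -big_distrr /=.
have le2 : \sum_(p | ok p) #|regular_over d (path_edges u p :|: H)| <= 2 * D ^ l * #|regular_over d H|.
  rewrite mulnC -sum_nat_const.
  apply: (@leq_trans (\sum_(p : l.-tuple 'I_n | uniq (u :: p)) #|regular_over d (path_edges u p :|: H)|)).
    rewrite big_mkcond [X in _ <= X]big_mkcond; apply: leq_sum => p _; rewrite /ok.
    by case: uniq => //=; case: ifP.
  under [X in X <= _]eq_bigr => p _ do rewrite -sum1_card big_mkcond /=.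
  rewrite exchange_big /= [X in _ <= X]big_mkcond; apply: leq_sum => G _.
  case: ifP => GH; last first.
    rewrite big1 // => p _; case: ifP => //; rewrite in_regular_over subUset => /and3P[h1 _ h2].
    by move: GH; rewrite in_regular_over h1 h2.
  apply: leq_trans (card_paths u l GH _); last by lia.
  rewrite -sum1_card -big_mkcondr /= (eq_bigl (fun p : l.-tuple 'I_n => p \in
    [set p : l.-tuple 'I_n | uniq (u :: p) && (path_edges u p \subset G)])) //.
  move=> p; move: GH; rewrite [p \in _]inE !in_regular_over subUset => /andP[h1 h2].
  by rewrite h1 h2 /= andbT.
apply: leq_trans (leq_mul (leqnn _) le2) _.
rewrite mulnA leq_mul2r; apply/orP; right; rewrite expnS.
by rewrite mulnA [8 * _]mulnA leq_mul2r; apply/orP; right; lia.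
Qed.

Lemma geom_sum m : \sum_(l < m) D ^ l.+1 <= 2 * D ^ m.
Proof.
elim: m => [|m IH]; first by rewrite big_ord0.
rewrite big_ord_recr /=; apply: leq_trans (leq_add IH (leqnn _)) _.
have : 2 * D ^ m <= D * D ^ m by rewrite leq_mul2r; lia.
by rewrite expnS; lia.
Qed.

(** A path that reaches position [i] of [hs] may have at most [r - 1 - i] edges,
    so the double sum is dominated by its term with [i = 0]. *)
Lemma geom_sum2 (r s : nat) :
  \sum_(i < s) \sum_(l < r | l + i + 2 <= r) D ^ l.+1 <= 4 * D ^ r.-1.
Proof.
have inner i : \sum_(l < r | l + i + 2 <= r) D ^ l.+1 <=
    if i < r.-1 then 2 * D ^ (r.-1 - i) else 0.
  case: ifP => ir; last by rewrite big1 // => l; lia.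
  have le : r.-1 - i <= r by lia.
  apply: leq_trans (geom_sum _); rewrite (big_ord_widen r (fun l => D ^ l.+1) le).
  rewrite big_mkcond [X in _ <= X]big_mkcond /=; apply: leq_sum => l _.
  by case: ifP => // h; rewrite ifT //; lia.
suff : \sum_(i < s) \sum_(l < r | l + i + 2 <= r) D ^ l.+1 + 4 * D ^ (r.-1 - s)
    <= 4 * D ^ r.-1 by apply: leq_trans; exact: leq_addr.
elim: s => [|s IH]; first by rewrite big_ord0 subn0.
apply: leq_trans IH; rewrite big_ord_recr /= -addnA leq_add2l.
apply: leq_trans (leq_add (inner s) (leqnn _)) _.
case: ifP => h; last by rewrite (_ : r.-1 - s.+1 = r.-1 - s) //; lia.
have -> : r.-1 - s = (r.-1 - s.+1).+1 by lia.
rewrite expnS; set X := D ^ _.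
have : 2 * X <= D * X by rewrite leq_mul2r; lia.
by lia.
Qed.

Lemma card_bigcup_le (I : finType) (T : finType) (F : I -> {set T}) :
  #|\bigcup_i F i| <= \sum_i #|F i|.
Proof.
elim/big_ind2: _ => [|S x T' y h1 h2|//]; first by rewrite cards0.
by apply: leq_trans (leq_card_setU _ _) (leq_add h1 h2).
Qed.

Section Events.
Variables (r : nat) (u v : 'I_n) (H : {set {set 'I_n}}) (hs : seq 'I_n).

(** The three ways in which a switch can meet a short cycle.  Some path leads from
    [u] to a vertex of [hs] (which is [v], followed by the part of [H] hanging at
    [v]); the edge [ua] or [vb] closes a short cycle; or a path of the form
    [u a ... b v] turns into a short cycle through [ab]. *)
Definition reconnects G := [exists i : 'I_(size hs), [exists l : 'I_r,
  (l + i + 2 <= r) && (fresh_paths H G u (nth u hs i) l != set0)]].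
Definition loop_ends G x := \bigcup_(l < r) [set last x (val p) | p in fresh_paths H G x x l].
Definition link_ends G := \bigcup_(l < r)
  [set (thead p, last u (val p)) | p in fresh_paths H G u v l.+1].

Definition clean : {set triple} := [set t in ltriples d u v H |
  [&& ~~ reconnects t.1, t.2.1 \notin loop_ends t.1 u, t.2.2 \notin loop_ends t.1 v &
      t.2 \notin link_ends t.1]].

(** In [reconnects] the choice of [a] and [b] is free, in [loop_ends] the path
    determines one of them, and in [link_ends] both.  A determined end saves a
    factor [d - deg_H], at least [D], which compensates for the paths being longer
    by one step for each determined end. *)
Lemma card_unclean :
  0 < r -> degree H u <= 1 -> degree H v <= 1 ->
  (forall A, #|A| <= #|H| + r -> 2 * switch_loss d A <= n * d) ->
  n * #|ltriples d u v H :\: clean| <= 80 * D ^ r.-1 * #|ltriples d u v H|.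
Proof.
move=> r0 du1 dv1 small.
have total (D s1 s2 s3 s4 du dv E M : nat) : D <= du -> D <= dv ->
    n * s1 <= 32 * E * M -> n * s2 <= 16 * (D * E) * M -> n * s3 <= 16 * (D * E) * M ->
    n * s4 <= 16 * (D * (D * E)) * M ->
    n * s1 * du * dv + n * s2 * dv + n * s3 * du + n * s4 <= 80 * E * (du * dv * M).
  move=> duD dvD b1 b2 b3 b4.
  have c1 := leq_mul (leqnn (du * dv)) b1.
  have c2 := leq_mul (leqnn dv) b2.
  have c3 := leq_mul (leqnn du) b3.
  have m1 : D * (dv * E * M) <= du * (dv * E * M) by rewrite leq_mul2r duD orbT.
  have m2 : D * (du * E * M) <= dv * (du * E * M) by rewrite leq_mul2r dvD orbT.
  have m3 : D * D * (E * M) <= du * dv * (E * M) by rewrite leq_mul2r leq_mul ?orbT.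
  by move: c1 c2 c3 b4 m1 m2 m3; clear; lia.
set cl := clean.
set du := d - degree H u; set dv := d - degree H v.
set L := ltriples d u v H.
have duD : D <= du by rewrite /du; lia.
have dvD : D <= dv by rewrite /dv; lia.
pose S1 G := \sum_(i < size hs) \sum_(l < r | l + i + 2 <= r) #|fresh_paths H G u (nth u hs i) l|.
pose S2 G x := \sum_(l < r) #|fresh_paths H G x x l|.
pose S4 G := \sum_(l < r) #|fresh_paths H G u v l.+1|.
pose N x G := nbr (G :\: H) x.
pose X G := (if reconnects G then lpairs u v H G else set0) :|:
  setX (loop_ends G u) (N v G) :|: setX (N u G) (loop_ends G v) :|: link_ends G.
have sub : L :\: cl \subset [set t : triple | (t.1 \in regular_over d H) && (t.2 \in X t.1)].
  apply/subsetP => -[G [a b]]; rewrite in_setD => /andP[nc tL].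
  move: (tL); rewrite /L [in X in X -> _]inE /= => /andP[GH abL]; rewrite inE /= GH /=.
  move: nc; rewrite inE tL /= !negb_and !negbK.
  move: (abL); rewrite in_setX /= => /andP[aN bN].
  rewrite /X !in_setU !in_setX /= aN bN !andbT /= -!orbA => /or4P[h|->|->|->]; rewrite ?orbT //.
  by rewrite h abL.
have cN x G : G \in regular_over d H -> #|N x G| = d - degree H x.
  move=> GR; have sAG := regular_over_sub GR.
  by rewrite card_nbr ?(simpleS (subsetDl G H) (regular_over_simple GR)) // degreeD // (regular_over_degree _ GR).
have cX G : G \in regular_over d H -> #|X G| <= S1 G * (du * dv) + S2 G u * dv + S2 G v * du + S4 G.
  move=> GR.
  have cU (S T : {set 'I_n * 'I_n}) : #|S :|: T| <= #|S| + #|T| by apply: leq_card_setU.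
  have cl2 x : #|loop_ends G x| <= S2 G x.
    by apply: leq_trans (card_bigcup_le _) (leq_sum _ _) => l _; exact: leq_imset_card.
  apply: leq_trans (cU _ _) (leq_add _ _); last first.
    by apply: leq_trans (card_bigcup_le _) (leq_sum _ _) => l _; exact: leq_imset_card.
  apply: leq_trans (cU _ _) (leq_add _ _); last first.
    by rewrite cardsX cN // mulnC leq_mul2r cl2 orbT.
  apply: leq_trans (cU _ _) (leq_add _ _); last first.
    by rewrite cardsX cN // leq_mul2r cl2 orbT.
  case: ifP => [|_]; last by rewrite cards0.
  move=> /existsP[i /existsP[l /andP[hl hf]]]; rewrite (card_lpairs _ _ GR) leq_pmull //.
  rewrite /S1 (bigD1 i) //= (bigD1 l) //= -addnA addn_gt0.
  by rewrite card_gt0 hf.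
apply: leq_trans (leq_mul (leqnn _) (subset_leq_card sub)) _.
rewrite -sum1_card big_triples.
have h1 : \sum_(G in regular_over d H) \sum_(ab in X G) 1 <=
   \sum_(G in regular_over d H) (S1 G * (du * dv) + S2 G u * dv + S2 G v * du + S4 G).
  by apply: leq_sum => G GR; rewrite sum1_card; exact: cX.
apply: leq_trans (leq_mul (leqnn n) h1) _.
rewrite !big_split /= -!big_distrl /= !mulnDr !mulnA.
set M := #|regular_over d H|.
have small' l : l < r.+1 -> forall A, #|A| <= #|H| + l -> 2 * switch_loss d A <= n * d.
  by move=> lr A hA; apply: small; apply: leq_trans hA _; rewrite leq_add2l.
have b1 : n * \sum_(G in regular_over d H) S1 G <= 32 * D ^ r.-1 * M.
  rewrite /S1 exchange_big /= big_distrr /=.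
  apply: (@leq_trans (\sum_(i < size hs) \sum_(l < r | l + i + 2 <= r) 8 * D ^ l.+1 * M)).
    apply: leq_sum => i _; rewrite exchange_big big_distrr /=; apply: leq_sum => l _.
    by apply: sum_fresh_paths; apply: small'; rewrite ltnS ltnW.
  under eq_bigr => i _ do rewrite -big_distrl -big_distrr /=.
  rewrite -big_distrl -big_distrr /= leq_mul2r; apply/orP; right.
  by rewrite (_ : 32 = 8 * 4) // -mulnA leq_mul2l geom_sum2 orbT.
have b2 x : n * \sum_(G in regular_over d H) S2 G x <= 16 * D ^ r * M.
  rewrite /S2 exchange_big /= big_distrr /=.
  apply: (@leq_trans (\sum_(l < r) 8 * D ^ l.+1 * M)).
    apply: leq_sum => l _.
    by apply: sum_fresh_paths; apply: small'; rewrite ltnS ltnW.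
  rewrite -big_distrl -big_distrr /= leq_mul2r; apply/orP; right.
  by rewrite (_ : 16 = 8 * 2) // -mulnA leq_mul2l geom_sum orbT.
have b4 : n * \sum_(G in regular_over d H) S4 G <= 16 * D ^ r.+1 * M.
  rewrite /S4 exchange_big /= big_distrr /=.
  apply: (@leq_trans (\sum_(l < r) 8 * (D ^ l.+1 * D) * M)).
    apply: leq_sum => l _; rewrite -expnSr.
    by apply: sum_fresh_paths; apply: small'; rewrite ltnS.
  rewrite -big_distrl -big_distrr -big_distrl /= leq_mul2r; apply/orP; right.
  by rewrite (_ : 16 = 8 * 2) // expnSr -mulnA leq_mul2l mulnA leq_mul2r geom_sum !orbT.
have -> : #|L| = du * dv * M by rewrite card_ltriples.
have Er : D ^ r = D * D ^ r.-1 by rewrite -expnS prednK.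
rewrite expnS Er in b4; set E := D ^ r.-1 in Er b1 b4 *.
have b2' x : n * \sum_(G in regular_over d H) S2 G x <= 16 * (D * E) * M by rewrite -Er.
exact: total duD dvD b1 (b2' u) (b2' v) b4.
Qed.

End Events.
End BadSwitchings.

(** * Clean switchings preserve the short cycles *)

Section CyclePreservation.
Import mathcomp.boot.fintype mathcomp.boot.finset.
Import Order.TTheory GRing.Theory Num.Theory.
Local Open Scope nat_scope.
Local Open Scope set_scope.
Variables (n d r : nat).
Implicit Types (G A B C : {set {set 'I_n}}) (a b w x y z : 'I_n) (e : {set 'I_n}).
Implicit Types p q s : seq 'I_n.

(* When [v] is a new vertex, [hs] is [v] alone.  When [uv] closes the path [H]
   into the cycle [al], [hs] lists the vertices of [H] from [v] to [u].  The
   hypotheses cover both cases: a path within [H] starting at [v] follows [hs],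
   and if it reaches [u], then adding [uv] yields [al]. *)
Variables (u v : 'I_n) (H al : {set {set 'I_n}}) (hs : seq 'I_n).
Hypothesis r2 : 2 < r.
Hypothesis uv : u != v.
Hypothesis uvH : [set u; v] \notin H.
Hypothesis hs0 : 0 < size hs.
Hypothesis hs_head : nth u hs 0 = v.
Hypothesis hs_step : forall t y, t < size hs -> [set y; nth u hs t] \in H ->
  y \in take t hs \/ (t.+1 < size hs /\ y = nth u hs t.+1).
Hypothesis hs_end : forall t, t < size hs -> nth u hs t = u -> t.+1 = size hs.
Hypothesis hs_close : forall p, u :: p = rev hs -> [set v; u] |: path_edges u p = al.

Lemma reconnects_fresh G p t : ~~ reconnects r u H hs G ->
  t < size hs -> size p + t + 2 <= r -> ~~ fresh_path H G u (nth u hs t) p.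
Proof.
move=> nr tl pr; apply: contra nr => fp.
have pr' : size p < r by move: pr; clear; lia.
apply/existsP; exists (Ordinal tl); apply/existsP; exists (Ordinal pr'); rewrite pr /=.
by apply/set0Pn; exists (in_tuple p); rewrite inE.
Qed.

Lemma loop_ends_fresh G x p : last x p \notin loop_ends r H G x ->
  size p < r -> ~~ fresh_path H G x x p.
Proof.
move=> nl pr; apply: contra nl => fp; apply/bigcupP; exists (Ordinal pr) => //.
by apply/imsetP; exists (in_tuple p); rewrite ?inE.
Qed.

Lemma link_ends_fresh G y p : (y, last u (y :: p)) \notin link_ends r u v H G ->
  size p < r -> ~~ fresh_path H G u v (y :: p).
Proof.
move=> nl pr; apply: contra nl => fp; apply/bigcupP; exists (Ordinal pr) => //.
apply/imsetP; exists (in_tuple (y :: p)); first by rewrite inE.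
by congr (_, _).
Qed.

(** Follow the path backwards from its end: as long as its edges belong to [H] it
    has to run along [hs], and the first edge outside [H] is the last step of a
    path counted by [reconnects]. *)
Lemma path_to_tail G p t : ~~ reconnects r u H hs G ->
  t < size hs -> uniq (u :: p) -> path_edges u p \subset G ->
  last u p = nth u hs t -> {in take t hs, forall z, z \notin u :: p} ->
  size p + t + 1 <= r -> u :: p = rev (drop t hs).
Proof.
move=> nr; elim/last_ind: p t => [|p x IH] t tl.
  move=> _ _ /= /esym ut _ _; rewrite (drop_nth u tl) ut.
  by rewrite drop_oversize // hs_end.
rewrite -rcons_cons rcons_uniq path_edges_rcons subUset sub1set last_rcons size_rcons.
move=> /andP[xp up] /andP[yxG pG] xE tk sz.
have yxp : [set last u p; x] \notin path_edges u p by rewrite setUC path_edges_notin.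
have szp : size p + t + 2 <= r by move: sz; clear; lia.
have := reconnects_fresh nr tl szp; rewrite /fresh_path -xE yxG up pG yxp /= andbT negbK.
rewrite {1}xE => /(hs_step tl)[/tk|[tl1 yE]].
  by rewrite mem_rcons inE mem_last orbT.
have tk' : {in take t.+1 hs, forall z, z \notin u :: p}.
  move=> z; rewrite (take_nth u tl) mem_rcons inE => /orP[/eqP->|/tk]; first by rewrite -xE.
  by rewrite mem_rcons inE negb_or => /andP[].
have sz' : size p + t.+1 + 1 <= r by move: sz; clear; lia.
by rewrite -rcons_cons (IH _ tl1 up pG yE tk' sz') (drop_nth u tl) rev_cons xE.
Qed.

(** A cycle that is destroyed contains [ua] or [vb].  A cycle that is created
    contains [uv], [ab] or both; opened at one of them it becomes a path from [u]
    to [v] or from [a] to [b].  Such a path yields one of the configurations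
    excluded by [clean], unless the cycle is [al]. *)
Lemma clean_preserves G a b : (G, (a, b)) \in clean d r u v H hs ->
  (G, (a, b)) \in lvalid d u v H /\
  forall B, is_cycle B -> #|B| <= r -> B != al ->
    (B \subset (fwd u v (G, (a, b))).1) = (B \subset G).
Proof.
rewrite inE /= => /andP[tL /and4P[nrec nla nlb nlk]].
move: (tL); rewrite inE /= in_setX /= !in_nbr !in_setD.
move=> /andP[GR /andP[/andP[uaH uaG] /andP[vbH vbG]]].
have sG := regular_over_simple GR.
have ua := simple_neq sG uaG; have vb := simple_neq sG vbG.
have ea x p : last x p \notin loop_ends r H G x -> size p < r -> uniq (x :: p) ->
    [set x; last x p] \in G -> [set x; last x p] \notin H ->
    [set x; last x p] \notin path_edges x p -> path_edges x p \subset G -> False.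
  move=> nl sz up h1 h2 h3 h4; have := loop_ends_fresh nl sz.
  by rewrite /fresh_path setUC up h1 h2 h3 h4.
have rec0 p : size p + 2 <= r -> ~~ fresh_path H G u v p.
  by move=> sz; rewrite -hs_head reconnects_fresh // addn0.
have uvG : [set u; v] \notin G.
  apply/negP => uvG; have := rec0 [::] (ltnW r2).
  by rewrite /fresh_path /= uvG sub0set uvH !inE.
have av : a != v by apply: contraNneq uvG => <-.
have bu : b != u by apply: contraNneq uvG => <-; rewrite setUC.
have ab : a != b.
  apply/eqP => ab; rewrite -{}ab in vbG vbH; have := rec0 [:: a] r2.
  rewrite /fresh_path /= setU0 sub1set uaG inE ua /= [[set a; v]]setUC vbG vbH in_set1 /=.
  by rewrite set2_neq // eq_sym.
have abG : [set a; b] \notin G.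
  apply/negP => abG; have := link_ends_fresh (y := a) (p := [:: b]) nlk (ltnW r2).
  rewrite /fresh_path /= setU0 subUset !sub1set uaG abG !inE negb_or ua (eq_sym u) bu ab /=.
  have vu : v != u by rewrite eq_sym.
  have va : v != a by rewrite eq_sym.
  by rewrite [[set b; v]]setUC vbG vbH negb_or !set2_neq.
have tV : (G, (a, b)) \in lvalid d u v H.
  by rewrite lvalidE GR !inE uaH uaG vbH vbG uvG ab abG.
split=> // B cB sB Bal; pose G' := (fwd u v (G, (a, b))).1; rewrite -/G'.
have inG' e : e \in G' = (e != [set u; a]) && (e != [set v; b]) && (e \in G)
     || (e == [set u; v]) || (e == [set a; b]).
  by rewrite /G' /fwd /swap /= !inE negb_or orbA.
apply/idP/idP => [BG'|BG]; last first.
  apply/subsetP => e eB; rewrite inG' (subsetP BG _ eB) andbT.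
  have -> : e != [set u; a].
    apply: contraTneq eB => ->; apply/negP => uaB.
    have [p [up lp p1 cp Bp]] := cycle_from cB uaB.
    apply: (ea u p); rewrite ?lp // -?lp; first by rewrite -cp.
      by rewrite setUC closing_edge_notin.
    by apply: subset_trans BG; rewrite Bp subsetUr.
  have -> // : e != [set v; b].
  apply: contraTneq eB => ->; apply/negP => vbB.
  have [p [up lp p1 cp Bp]] := cycle_from cB vbB.
  apply: (ea v p); rewrite ?lp // -?lp; first by rewrite -cp.
    by rewrite setUC closing_edge_notin.
  by apply: subset_trans BG; rewrite Bp subsetUr.
(* [K] is the part common to the graphs before and after the switch. *)
pose K := G :\: [set [set u; a]; [set v; b]].
have KG : K \subset G by apply: subsetDl.
have subK C : C \subset B -> [set u; v] \notin C -> [set a; b] \notin C -> C \subset K.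
  move=> /subsetP CB uvC abC; apply/subsetP => e eC.
  have := subsetP BG' e (CB e eC); rewrite inG' !inE negb_or.
  have /negPf-> : e != [set u; v] by apply: contraNneq uvC => <-.
  have /negPf-> : e != [set a; b] by apply: contraNneq abC => <-.
  by rewrite !orbF.
have uaK : [set u; a] \notin K by rewrite !inE eqxx.
have vbK : [set v; b] \notin K by rewrite !inE eqxx orbT.
have ea' p : uniq (u :: p) -> path_edges u p \subset K -> size p < r -> last u p != a.
  move=> up pK sz; apply/eqP => lp; apply: (ea u p); rewrite ?lp //.
    by apply: contra uaK; apply/subsetP.
  exact: subset_trans pK KG.
have eb' p : uniq (v :: p) -> path_edges v p \subset K -> size p < r -> last v p != b.
  move=> up pK sz; apply/eqP => lp; apply: (ea v p); rewrite ?lp //.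
    by apply: contra vbK; apply/subsetP.
  exact: subset_trans pK KG.
(* If the cycle uses both new edges, its part from [u] to the first end of [ab]
   is a path in [K] to [a], which closes a cycle with [ua], or to [b], which is
   then prolonged by [bv]. *)
have [uvB|uvB] := boolP ([set u; v] \in B).
  have [p [up lp p1 cp Bp]] := cycle_from cB uvB; exfalso.
  have uvp : [set u; v] \notin path_edges u p by rewrite -lp setUC closing_edge_notin.
  have pB : path_edges u p \subset B by rewrite Bp subsetUr.
  have [abp|abp] := boolP ([set a; b] \in path_edges u p); last first.
    have pK := subK _ pB uvp abp.
    have := path_to_tail nrec hs0 up (subset_trans pK KG).
    rewrite take0 hs_head drop0 lp => tl; move/eqP: Bal; apply.
    by rewrite Bp hs_close // tl // addn0 addn1 -cp.
  have [p1' [y [p2 [pE abE]]]] := path_edges_split abp.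
  have up1 : uniq (u :: p1') by move: up; rewrite pE -cat_cons cat_uniq => /andP[].
  have p1p : path_edges u p1' \subset path_edges u p by rewrite pE path_edges_cat subsetUl.
  have abp1 : [set a; b] \notin path_edges u p1'.
    rewrite abE setUC path_edges_notin //.
    move: up; rewrite pE -cat_cons cat_uniq => /and3P[_ /hasPn h _].
    by apply: h; rewrite mem_head.
  have p1K : path_edges u p1' \subset K.
    by apply: subK => //; [exact: subset_trans p1p pB | exact: contra (subsetP p1p _) uvp].
  have szp1 : size p1' + 2 <= r.
    by move: cp sB; rewrite pE size_cat /=; clear; lia.
  have : last u p1' \in [set a; b] by rewrite abE set21.
  rewrite !inE => /orP[]/eqP lE.
    by have := ea' _ up1 p1K; rewrite lE eqxx => hf; have : false by apply: hf; move: szp1; clear; lia.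
  have vp1 : v \notin u :: p1'.
    move: up; rewrite pE -cat_cons cat_uniq => /and3P[_ /hasPn h _].
    by apply: h; rewrite -lp pE last_cat /= mem_last.
  have := rec0 p1' szp1; rewrite /fresh_path lE setUC up1 (subset_trans p1K KG) vbG vbH /=.
  by rewrite path_edges_notin.
have [abB|abB] := boolP ([set a; b] \in B); last by apply: subset_trans (subK B _ uvB abB) KG.
(* If the path from [a] to [b] avoids [u] and [v] it extends to [u a ... b v];
   otherwise [ua] or [vb] already closes a short cycle. *)
exfalso; have [p [up lp p1 cp Bp]] := cycle_from cB abB.
have pB : path_edges a p \subset B by rewrite Bp subsetUr.
have pK : path_edges a p \subset K.
  apply: subK => //; last by rewrite -lp setUC closing_edge_notin.
  exact: contra (subsetP pB _) uvB.
have szp : size p < r by rewrite -cp.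
have up' : u \notin a :: p.
  rewrite inE negb_or ua; apply/negP => uap; case/splitPr: uap up pK szp => p1' p2.
  rewrite -cat_rcons path_edges_cat size_cat subUset -cat_cons cat_uniq.
  move=> /andP[up1 _] /andP[p1K _] szp1.
  have [q [uq lq sq qE]] := path_reverse up1 (last_rcons a p1' u).
  have := ea' _ uq; rewrite qE lq eqxx => /(_ p1K) h; have : false.
    by apply: h; move: szp1 sq; rewrite size_rcons; clear; lia.
  by [].
have vp' : v \notin a :: p.
  rewrite inE negb_or eq_sym av; apply/negP => vap.
  case/splitPr: vap up pK szp lp => p1' p2.
  rewrite path_edges_cat size_cat subUset -cat_cons cat_uniq last_cat /=.
  move=> /and3P[_ _ up2] /andP[_]; rewrite subUset => /andP[_ p2K] szp2 lp2.
  by have := eb' _ up2 p2K; rewrite lp2 eqxx => h; have : false by apply: h; move: szp2 => /=; clear; lia.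
have := @link_ends_fresh G a p; rewrite /= lp => /(_ nlk szp).
rewrite /fresh_path cons_uniq up' up /= subUset sub1set uaG (subset_trans pK KG) lp.
rewrite setUC vbG vbH /= !inE negb_or path_edges_notin // andbT.
by rewrite set2_neq // 1?eq_sym.
Qed.

End CyclePreservation.

(** * Inserting one edge of a cycle *)

Section EdgeChain.
Import mathcomp.boot.fintype mathcomp.boot.finset.
Import Order.TTheory GRing.Theory Num.Theory.
Local Open Scope set_scope.
Local Open Scope ring_scope.
Variables (R : realFieldType) (n d r : nat).
Implicit Types (G A B C : {set {set 'I_n}}) (a b w x y z : 'I_n) (e : {set 'I_n}).
Implicit Types p q s : seq 'I_n.
Local Notation D := d.-1.
Hypothesis d2 : (2 < d)%N.
Hypothesis r2 : (2 < r)%N.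
Hypothesis nbig : (12 * D ^ r.-1 <= n)%N.

Let eta : R := (D ^ r.-1)%:R / n%:R.

Lemma leq_expn_pred : (r <= D ^ r.-1)%N.
Proof.
clear -d2 r2.
have le1 : (2 ^ r.-1 <= D ^ r.-1)%N by rewrite leq_exp2r; lia.
have : (r.-1 < 2 ^ r.-1)%N by rewrite ltn_expl.
by lia.
Qed.

Lemma leq_deg_expn_pred : (d <= D ^ r.-1)%N.
Proof.
clear -d2 r2.
have le1 : (D ^ 2 <= D ^ r.-1)%N by rewrite leq_exp2l; lia.
by apply: leq_trans le1; rewrite expnS expn1; nia.
Qed.

Lemma switch_loss_le A : (#|A| <= 2 * r)%N -> (switch_loss d A <= 6 * d * D ^ r.-1)%N.
Proof.
rewrite /switch_loss => Ar; have := leq_expn_pred; have := leq_deg_expn_pred.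
by move: (D ^ r.-1)%N => E; nia.
Qed.

Lemma switch_small A : (#|A| <= 2 * r)%N -> (2 * switch_loss d A <= n * d)%N.
Proof.
move=> /switch_loss_le; move: nbig; move: (D ^ r.-1)%N (switch_loss d A) => E s; nia.
Qed.

Let n0 : 0 < n%:R :> R.
Proof.
have := leq_expn_pred; rewrite ltr0n; move: nbig; lia.
Qed.

Let eta_ge0 : 0 <= eta. Proof. by rewrite divr_ge0 ?ler0n. Qed.
Let eta_le : 12 * eta <= 1.
Proof. by rewrite /eta mulrA ler_pdivrMr // mul1r -natrM ler_nat. Qed.

Section OneCycle.
Variables (al : {set {set 'I_n}}) (h : {set {set 'I_n}} -> R).
Hypothesis h1 : forall G, `|h G| <= 1.
Hypothesis h_al : forall G G', (forall B, is_cycle B -> (#|B| <= r)%N -> B != al ->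
  (B \subset G) = (B \subset G')) -> h G = h G'.

Definition hsum A := \sum_(G in regular_over d A) h G.
Local Notation N A := (#|regular_over d A|%:R : R).
Let delta : R := 172 * eta.

(** Both sides of the switching identity are divided by [n * d].  The unclean
    triples contribute [2 * 80 * eta] to the error and the invalid ones
    [2 * 6 * eta], where [eta = D^(r-1) / n]. *)
Lemma hsum_step (u v : 'I_n) (H : {set {set 'I_n}}) (hs : seq 'I_n) :
  u != v -> [set u; v] \notin H -> (#|H| <= r)%N ->
  (degree H u <= 1)%N -> (degree H v <= 1)%N ->
  (0 < size hs)%N -> nth u hs 0 = v ->
  (forall t y, (t < size hs)%N -> [set y; nth u hs t] \in H ->
    y \in take t hs \/ ((t.+1 < size hs)%N /\ y = nth u hs t.+1)) ->
  (forall t, (t < size hs)%N -> nth u hs t = u -> t.+1 = size hs) ->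
  (forall p, u :: p = rev hs -> [set v; u] |: path_edges u p = al) ->
  let q := ((d - degree H u) * (d - degree H v))%:R / (n * d)%:R in
  `|hsum ([set u; v] |: H) - q * hsum H| <= delta * q * N H /\
  N ([set u; v] |: H) <= (1 + delta) * q * N H.
Proof.
move=> uv uvH Hr du dv hs0 hs_head hs_step hs_end hs_close.
set H' := [set u; v] |: H; set X := ((d - _) * _)%N => q.
set S := clean d r u v H hs.
have SV : S \subset lvalid d u v H.
  apply/subsetP => -[G [a b]] tS.
  by case: (clean_preserves r2 uv uvH hs0 hs_head hs_step hs_end hs_close tS).
have hS : {in S, forall t, h (fwd u v t).1 = h t.1}.
  move=> [G [a b]] tS; apply: h_al.
  by case: (clean_preserves r2 uv uvH hs0 hs_head hs_step hs_end hs_close tS).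
have := switch_sum_diff uv uvH SV h1 hS.
have EL : \sum_(t in ltriples d u v H) h t.1 = X%:R * hsum H.
  rewrite big_triples /= mulr_sumr; apply: eq_bigr => G GR.
  by rewrite sumr_const (card_lpairs _ _ GR) mulr_natl.
have ET : \sum_(t in rtriples d u v H) h t.1 = (n * d)%:R * hsum H'.
  rewrite big_triples /= mulr_sumr; apply: eq_bigr => G GR.
  rewrite sumr_const mulr_natl; congr (_ *+ _).
  have sG := regular_over_simple GR; rewrite card_rpairs // -sum_degree //.
  by under eq_bigr do rewrite (regular_over_degree _ GR); rewrite sum_nat_const card_ord.
rewrite EL ET => diff.
have small A : (#|A| <= #|H| + r)%N -> (2 * switch_loss d A <= n * d)%N.
  by move=> hA; apply: switch_small; lia.
have bad := card_unclean d2 hs (ltnW (ltnW r2)) du dv small.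
rewrite card_ltriples // -/X in bad.
have loss : (switch_loss d H <= 6 * d * D ^ r.-1)%N by apply: switch_loss_le; lia.
have rbad : (#|rtriples d u v H :\: rvalid d u v H| <= 6 * d * D ^ r.-1 * #|regular_over d H'|)%N.
  by apply: leq_trans (card_rinvalid d u v H) _; rewrite leq_mul2r loss orbT.
have tot : (n * d * #|regular_over d H'| <= X * #|regular_over d H| + 6 * d * D ^ r.-1 * #|regular_over d H'|)%N.
  apply: leq_trans (rtriples_le d uv uvH) _.
  by rewrite leq_add2l leq_mul2r loss orbT.
clearbody X.
have d0 : 0 < d%:R :> R by rewrite ltr0n; move: d2; clear; lia.
have nd0 : 0 < (n * d)%:R :> R by rewrite natrM mulr_gt0.
have XE : X%:R = q * (n%:R * d%:R) by rewrite -natrM /q divfK // gt_eqF.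
have EE : (D ^ r.-1)%:R = eta * n%:R by rewrite /eta divfK // gt_eqF.
have q0 : 0 <= q by rewrite /q divr_ge0 ?ler0n.
have badR : #|ltriples d u v H :\: S|%:R <= 80 * eta * (q * (n%:R * d%:R)) * N H.
  rewrite -XE -(ler_pM2l n0) -natrM.
  apply: le_trans (_ : (80 * D ^ r.-1 * (X * #|regular_over d H|))%:R <= _); first by rewrite ler_nat.
  by rewrite !natrM EE; lra.
have rbadR : #|rtriples d u v H :\: rvalid d u v H|%:R <= 6 * eta * (n%:R * d%:R) * N H'.
  apply: le_trans (_ : (6 * d * D ^ r.-1 * #|regular_over d H'|)%:R <= _); first by rewrite ler_nat.
  by rewrite !natrM EE; lra.
have totR : (n%:R * d%:R) * N H' <= (n%:R * d%:R) * (q * N H + 6 * eta * N H').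
  apply: le_trans (_ : (X * #|regular_over d H| + 6 * d * D ^ r.-1 * #|regular_over d H'|)%:R <= _).
    by rewrite -!natrM ler_nat.
  by rewrite natrD !natrM EE XE; lra.
rewrite ler_pM2l ?mulr_gt0 // in totR.
have N0 : 0 <= N H' by rewrite ler0n.
have qN : 0 <= q * N H by rewrite mulr_ge0 ?ler0n.
have N'le : N H' <= (1 + 12 * eta) * (q * N H).
  have e1 : 0 <= eta * (1 - 12 * eta) * N H'.
    by rewrite !mulr_ge0 // subr_ge0.
  have e2 := ler_wpM2l (_ : 0 <= 1 + 12 * eta) totR.
  have := e2 (_ : _); rewrite addr_ge0 ?mulr_ge0 // => /(_ isT).
  by move: e1; set Y := q * N H; lra.
have N'le2 : N H' <= 2 * (q * N H).
  apply: le_trans N'le _; apply: ler_wpM2r => //.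
  by move: eta_le; lra.
split; last first.
  rewrite -mulrA; apply: le_trans N'le _; apply: ler_wpM2r => //.
  by rewrite /delta; move: eta_ge0; lra.
rewrite distrC -(ler_pM2l nd0) -[X in X * `|_| <= _](gtr0_norm nd0) -normrM mulrBr.
rewrite mulrA [(n * d)%:R * q]mulrC natrM -XE -natrM.
apply: le_trans diff _; rewrite natrD natrM.
have e3 : eta * (n%:R * d%:R) * N H' <= eta * (n%:R * d%:R) * (2 * (q * N H)).
  by apply: ler_wpM2l => //; rewrite !mulr_ge0 // ltW.
move: badR rbadR e3; rewrite /delta natrM.
set Z := (n%:R * d%:R); set M := N H; set M' := N H'; lra.
Qed.

End OneCycle.
End EdgeChain.

(** * Inserting a whole cycle *)

Section CycleFactor.
Import mathcomp.boot.fintype mathcomp.boot.finset.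
Import Order.TTheory GRing.Theory Num.Theory.
Local Open Scope set_scope.
Local Open Scope ring_scope.
Variables (R : realFieldType) (n d r : nat).
Implicit Types (G A B C : {set {set 'I_n}}) (a b w x y z : 'I_n) (e : {set 'I_n}).
Implicit Types p q s : seq 'I_n.
Local Notation D := d.-1.
Hypothesis d2 : (2 < d)%N.
Hypothesis r2 : (2 < r)%N.
Hypothesis nbig : (1000 * D ^ (2 * r - 1) <= n)%N.

Local Notation eta := ((D ^ r.-1)%:R / n%:R : R).
Local Notation delta := (172 * eta).

Lemma nbig12 : (12 * D ^ r.-1 <= n)%N.
Proof.
apply: leq_trans nbig; rewrite leq_mul // leq_exp2l; last by move: d2; clear; lia.
by move: r2; clear; lia.
Qed.

(** Relative errors multiply along the chain. *)
Lemma chain_bound (Phi Phi' Phi0 q Q M M' M0 del e : R) : 0 <= q -> 0 <= del ->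
  `|Phi - Q * Phi0| <= Q * (e - 1) * M0 -> M <= Q * e * M0 ->
  `|Phi' - q * Phi| <= del * q * M -> M' <= (1 + del) * q * M ->
  `|Phi' - Q * q * Phi0| <= Q * q * (e * (1 + del) - 1) * M0 /\
  M' <= Q * q * (e * (1 + del)) * M0.
Proof.
move=> q0 del0 h1 h2 h3 h4.
have h5 : q * M <= q * (Q * e * M0) by apply: ler_wpM2l.
have h6 : (del * q) * M <= (del * q) * (Q * e * M0) by apply: ler_wpM2l => //; apply: mulr_ge0.
split; last by apply: le_trans h4 _; lra.
have -> : Phi' - Q * q * Phi0 = (Phi' - q * Phi) + q * (Phi - Q * Phi0) by ring.
apply: le_trans (ler_normD _ _) _; rewrite normrM (ger0_norm q0).
have h7 : q * `|Phi - Q * Phi0| <= q * (Q * (e - 1) * M0) by apply: ler_wpM2l.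
by lra.
Qed.

(** The first edge of a path joins two vertices of degree 0 in the part inserted
    so far, and each further edge starts at a vertex of degree 1. *)
Definition path_weight k : R :=
  if k is k'.+1 then d%:R / n%:R * (D%:R / n%:R) ^+ k' else 1.

Section OneCycle.
Variables (al : {set {set 'I_n}}) (h : {set {set 'I_n}} -> R).
Hypothesis h1 : forall G, `|h G| <= 1.
Hypothesis h_al : forall G G', (forall B, is_cycle B -> (#|B| <= r)%N -> B != al ->
  (B \subset G) = (B \subset G')) -> h G = h G'.
Local Notation N A := (#|regular_over d A|%:R : R).
Local Notation hsum := (hsum d h).
Local Notation no_edges := (set0 : {set {set 'I_n}}).

Let n0 : (0 < n)%N.
Proof. by apply: leq_trans nbig; rewrite muln_gt0 expn_gt0; move: d2; clear; lia. Qed.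
Let d0 : (0 < d)%N. Proof. by move: d2; clear; lia. Qed.
Let nR : n%:R != 0 :> R. Proof. by rewrite pnatr_eq0 -lt0n. Qed.
Let dR : d%:R != 0 :> R. Proof. by rewrite pnatr_eq0 -lt0n. Qed.

Lemma delta_ge0 : 0 <= delta.
Proof. by rewrite mulr_ge0 // divr_ge0 ?ler0n. Qed.

Lemma path_chain x p : uniq (x :: p) -> (size p < r)%N ->
  `|hsum (path_edges x p) - path_weight (size p) * hsum no_edges|
     <= path_weight (size p) * ((1 + delta) ^+ size p - 1) * N no_edges /\
  N (path_edges x p) <= path_weight (size p) * (1 + delta) ^+ size p * N no_edges.
Proof.
elim/last_ind: p => [|p v IH] up sp.
  by rewrite /= expr0 !mul1r !subrr normr0 mul0r.
rewrite size_rcons in sp *; rewrite path_edges_rcons.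
move: up; rewrite -rcons_cons rcons_uniq => /andP[vp up].
have [IH1 IH2] := IH up (ltnW sp).
set u := last x p; set H := path_edges x p.
have uv : u != v by apply: contraNneq vp => <-; exact: mem_last.
have uvH : [set u; v] \notin H by rewrite setUC path_edges_notin.
have Hr : (#|H| <= r)%N by rewrite card_path_edges // ltnW // ltnW.
have du : degree H u = (p != [::]) by apply: degree_path_last.
have dv : degree H v = 0 by apply: degree_path_notin.
have step := hsum_step d2 r2 nbig12 h1 h_al (hs := [:: v]) uv uvH Hr.
rewrite du dv leq_b1 /= subn0 in step.
have [//|//|//|//||||s1 s2] := step.
- case=> [|t] y //= _; rewrite setUC (negPf (path_edges_notin _ vp)) //.
- by case=> [|t] //= _ vu; rewrite vu eqxx in uv.
- by move=> q [uv' _]; rewrite uv' eqxx in uv.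
rewrite exprSr.
have -> : path_weight (size p).+1 =
    path_weight (size p) * (((d - (p != [::])) * d)%:R / (n * d)%:R).
  rewrite /path_weight !natrM -mulf_div divff // mulr1; case: (p) => [|z p'] /=.
    by rewrite subn0 expr0 mulr1 mul1r.
  by rewrite subn1 exprSr mulrA.
apply: chain_bound IH1 IH2 s1 s2; first by rewrite divr_ge0 ?ler0n.
exact: delta_ge0.
Qed.

(** The closing edge joins two vertices of degree 1, which turns the first factor
    [d / n] of [path_weight] into the missing factors [D / n]. *)
Lemma cycle_chain x p : uniq (x :: p) -> (1 < size p)%N -> (size p < r)%N ->
  al = [set last x p; x] |: path_edges x p ->
  let k := (size p).+1 in
  `|hsum al - (D%:R / n%:R) ^+ k * hsum no_edges|
     <= (D%:R / n%:R) ^+ k * ((1 + delta) ^+ k - 1) * N no_edges /\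
  N al <= (D%:R / n%:R) ^+ k * (1 + delta) ^+ k * N no_edges.
Proof.
move=> up p1 sp alE k.
have [IH1 IH2] := path_chain up sp.
set u := last x p in alE; set H := path_edges x p in IH1 IH2 alE.
have pn : p != [::] by rewrite -size_eq0 -lt0n ltnW.
have uv : u != x.
  have : x \notin p by move: up; rewrite cons_uniq => /andP[].
  rewrite /u; case: (p) pn => //= z p' _; apply: contraNneq => <-; exact: mem_last.
have uvH : [set u; x] \notin H by apply: closing_edge_notin.
have Hr : (#|H| <= r)%N by rewrite card_path_edges // ltnW.
have du : degree H u = 1%N by rewrite degree_path_last // pn.
have dv : degree H x = 1%N by rewrite degree_path_head // pn.
have step := hsum_step d2 r2 nbig12 h1 h_al (hs := x :: p) uv uvH Hr.
rewrite du dv !subn1 -alE in step.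
have [//|//|//|//||||s1 s2] := step.
- by move=> t y tl; apply: path_edges_step.
- move=> t tl; have lE : u = nth u (x :: p) (size p) by rewrite nth_last.
  by rewrite {2}lE => /eqP; rewrite nth_uniq // => /eqP ->.
- by move=> q; rewrite rev_path => -[->]; rewrite /u path_edges_rev alE /u /H [[set x; _]]setUC.
have -> : (D%:R / n%:R) ^+ k = path_weight (size p) * ((D * D)%:R / (n * d)%:R).
  rewrite /k -(prednK (ltnW p1)) /path_weight 2!exprSr.
  rewrite !natrM; field; by rewrite nR dR.
rewrite exprSr; apply: chain_bound IH1 IH2 s1 s2; first by rewrite divr_ge0 ?ler0n.
exact: delta_ge0.
Qed.

Lemma ffact_le_expn m k : (m ^_ k <= m ^ k)%N.
Proof.
by elim: k => [|k IH]; rewrite ?ffactnSr ?expnSr ?ffactn0 // leq_mul // leq_subr.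
Qed.

Lemma ffact_ge k : (k <= n)%N ->
  (1 - (k ^ 2)%:R / n%:R) * n%:R ^+ k <= (n ^_ k)%:R :> R.
Proof.
elim: k => [|k IH] kn; first by rewrite mul0r subr0 mul1r.
have nk : (n ^_ k.+1)%:R = (n ^_ k)%:R * (n%:R - k%:R) :> R.
  by rewrite ffactnSr natrM natrB // ltnW.
have n1 : 0 < n%:R :> R by rewrite ltr0n.
have kn' : 0 <= n%:R - k%:R :> R by rewrite subr_ge0 ler_nat ltnW.
rewrite nk; apply: le_trans (ler_wpM2r kn' (IH (ltnW kn))).
rewrite exprS [X in _ <= X]mulrAC !mulrA; apply: ler_wpM2r.
  by rewrite exprn_ge0 // ltW.
rewrite !natrX -natr1; set K := k%:R; set m := n%:R in n1 kn' *.
have -> : (1 - (K + 1) ^+ 2 / m) * m = m - (K + 1) ^+ 2 by rewrite mulrBl divfK // mul1r.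
have -> : (1 - K ^+ 2 / m) * (m - K) = m - K - K ^+ 2 + K ^+ 3 / m by field.
have K0 : 0 <= K by rewrite ler0n.
have K3 : 0 <= K ^+ 3 / m by rewrite divr_ge0 ?exprn_ge0 // ltW.
by move: K0 K3; lra.
Qed.

Lemma one_plus_expn (x : R) k : 0 <= x -> 2 * (k%:R * x) <= 1 ->
  (1 + x) ^+ k <= 1 + 2 * (k%:R * x).
Proof.
move=> x0; elim: k => [|k IH] kx; first by rewrite expr0 mul0r mulr0 addr0.
have kx' : 2 * (k%:R * x) <= 1.
  by apply: le_trans kx; rewrite ler_pM2l // ler_wpM2r // ler_nat.
rewrite exprSr; apply: le_trans (ler_wpM2r _ (IH kx')) _; first by rewrite addr_ge0.
have := ler_wpM2r x0 kx'; rewrite -[in X in _ -> X]natr1.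
by set K := k%:R; lra.
Qed.

(** Besides the error accumulated along the cycle there are two small ones: the
    rate has the denominator [n ^_ k] instead of [n ^ k], and the graphs that
    contain the cycle are left out of the second sum. *)
Lemma cycle_insertion k : is_cycle al -> #|al| = k -> (k <= r)%N ->
  let lam : R := D%:R ^+ k / (n ^_ k)%:R in
  `|hsum al - lam * (hsum no_edges - hsum al)| <= lam * k%:R * (350 * eta) * N no_edges
  /\ lam <= 2 * eta.
Proof.
move=> c_al kE kr lam.
have [x [p [up p1 sp alE]]] : exists x p, [/\ uniq (x :: p), (1 < size p)%N,
    k = (size p).+1 & al = [set last x p; x] |: path_edges x p].
  move: (c_al) => /existsP[k' /existsP[s /and3P[k3 us /eqP sE]]].
  have : (0 < size s)%N by rewrite size_tuple; apply: leq_trans k3.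
  case E : (tval s) => [//|x p] _; exists x, p.
  have up : uniq (x :: p) by rewrite -E.
  have p1 : (1 < size p)%N by move: k3; rewrite -(size_tuple s) E.
  split=> //; last by rewrite sE -closed_walk_edgesE // -E.
  by rewrite -kE sE E card_closed_walk_edges.
have sp' : (size p < r)%N by rewrite -sp.
have := cycle_chain up p1 sp' alE; rewrite /= -sp.
set Q := (_ / _) ^+ k; set P := hsum no_edges; set A := hsum al.
set M := N no_edges; set e := (1 + _) ^+ k.
have n1 : 0 < n%:R :> R by rewrite ltr0n.
have k0 : (0 < k)%N by rewrite sp.
have kE1 : (k <= D ^ r.-1)%N by apply: leq_trans kr _; exact: leq_expn_pred d2 r2.
have EE : (1000 * (D ^ r.-1 * D ^ r.-1) <= n)%N.
  apply: leq_trans nbig; rewrite leq_mul // -expnD leq_exp2l; last by move: d2; clear; lia.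
  by move: r2; clear; lia.
have eta0 : 0 <= eta by rewrite divr_ge0 ?ler0n.
have kn : (k <= n)%N.
  apply: leq_trans kE1 _; apply: leq_trans nbig12; exact: leq_pmull.
have keta : 1000 * (k%:R * eta) <= 1.
  rewrite !mulrA ler_pdivrMr // mul1r -!natrM ler_nat; apply: leq_trans EE.
  by rewrite -mulnA leq_mul // leq_mul.
have k2n : (k ^ 2)%:R / n%:R <= k%:R * eta :> R.
  rewrite mulrA ler_pM2r ?invr_gt0 // -natrM ler_nat expnS expn1.
  by rewrite leq_mul.
have Q0 : 0 <= Q by rewrite exprn_ge0 // divr_ge0 ?ler0n.
have Qeta : Q <= eta.
  have Dn : D%:R / n%:R <= eta.
    rewrite ler_pM2r ?invr_gt0 // ler_nat -{1}[D]expn1 leq_exp2l; first by move: r2; clear; lia.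
    by move: d2; clear; lia.
  have Dn0 : 0 <= D%:R / n%:R :> R by rewrite divr_ge0 ?ler0n.
  apply: le_trans Dn; rewrite /Q -(prednK k0) exprS ler_piMr // exprn_ile1 //.
  rewrite ler_pdivrMr // mul1r ler_nat; apply: leq_trans nbig12.
  apply: leq_trans (leq_pmull _ _) => //; rewrite -{1}[D]expn1 leq_exp2l.
    by move: r2; clear; lia.
  by move: d2; clear; lia.
pose rho : R := (n ^_ k)%:R / n%:R ^+ k.
have rho_lam : lam * rho = Q.
  have f0 : (n ^_ k)%:R != 0 :> R by rewrite pnatr_eq0 -lt0n ffact_gt0.
  rewrite /lam /rho /Q expr_div_n; field; by rewrite f0 expf_neq0.
have rho_ge : 1 - k%:R * eta <= rho.
  rewrite /rho ler_pdivlMr ?exprn_gt0 //; apply: le_trans (ffact_ge kn).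
  by apply: ler_wpM2r; [rewrite exprn_ge0 // ltW | rewrite lerD2l lerN2].
have rho_le : rho <= 1.
  rewrite /rho ler_pdivrMr ?exprn_gt0 // mul1r -natrX ler_nat; exact: ffact_le_expn.
have lam0 : 0 <= lam by rewrite divr_ge0 ?exprn_ge0 ?ler0n.
have e_le : e <= 1 + 344 * (k%:R * eta).
  apply: le_trans (one_plus_expn _ _) _; [exact: delta_ge0| | ]; lra.
have M0 : 0 <= M by rewrite ler0n.
move=> [bA NA].
have PM : `|P| <= M.
  by apply: le_trans (ler_norm_sum _ _ _) _; apply: le_trans (ler_sum _ (fun G _ => h1 G)) _; rewrite sumr_const.
have AM : `|A| <= N al.
  by apply: le_trans (ler_norm_sum _ _ _) _; apply: le_trans (ler_sum _ (fun G _ => h1 G)) _; rewrite sumr_const.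
have lamQ : lam - Q <= lam * (k%:R * eta).
  have := ler_wpM2l lam0 rho_ge; rewrite rho_lam; lra.
have Qlam : Q <= lam by have := ler_wpM2l lam0 rho_le; rewrite rho_lam; lra.
have lam2 : lam <= 2 * Q.
  have := ler_wpM2l lam0 (_ : k%:R * eta <= 1 / 2); lra.
split; last by lra.
have -> : A - lam * (P - A) = (A - Q * P) + ((Q - lam) * P + lam * A) by ring.
set K := k%:R * eta in keta k2n rho_ge e_le lamQ *.
have etaK : eta <= K by rewrite /K ler_peMl // ler1n.
have t1 : Q * (e - 1) * M <= lam * (344 * K) * M.
  apply: ler_wpM2r => //; apply: ler_pM => //; last by lra.
  by rewrite subr_ge0 exprn_ege1 // lerDl delta_ge0.
have t2 : `|(Q - lam) * P| <= lam * K * M.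
  rewrite normrM distrC [`|lam - Q|]ger0_norm ?subr_ge0 //.
  by apply: ler_pM; rewrite ?subr_ge0.
have t3 : `|lam * A| <= lam * (2 * K) * M.
  rewrite normrM (ger0_norm lam0) -mulrA; apply: ler_wpM2l => //.
  apply: le_trans AM _; apply: le_trans NA _; apply: ler_wpM2r => //.
  have : Q * e <= K * 2 by apply: ler_pM => //; [rewrite exprn_ge0 // addr_ge0 // delta_ge0 | lra | lra].
  by lra.
apply: le_trans (ler_normD _ _) _; apply: le_trans (lerD bA (ler_normD _ _)) _.
have t4 : 0 <= lam * K * M by rewrite !mulr_ge0 //; move: etaK eta0; lra.
have -> : lam * k%:R * (350 * eta) * M = 350 * (lam * K * M) by rewrite /K; ring.
by move: t1 t2 t3 t4; lra.
Qed.

End OneCycle.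
End CycleFactor.

(** * Coordinatewise comparison with independent variables *)

Section Telescoping.
Import mathcomp.boot.fintype mathcomp.boot.finset.
Import Order.TTheory GRing.Theory Num.Theory.
Local Open Scope set_scope.
Local Open Scope ring_scope.
Variables (R : realFieldType) (I : finType) (lam : I -> R).
Hypothesis lam0 : forall i, 0 <= lam i.
Implicit Types (S T : {set I}) (f g : {set I} -> R) (i j : I) (s : seq I).

Definition resample i f S : R := (f (S :\ i) + lam i * f (i |: S)) / (1 + lam i).

Definition bern_weight S : R := \prod_i ((if i \in S then lam i else 1) / (1 + lam i)).

Definition bern_mean f : R := \sum_S bern_weight S * f S.

Let lam1 i : 0 < 1 + lam i. Proof. by rewrite ltr_pwDl. Qed.
Let lam1n i : 1 + lam i != 0. Proof. by rewrite gt_eqF. Qed.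

Lemma sum_toggle i (F : {set I} -> R) :
  \sum_S F S = \sum_(S : {set I} | i \notin S) (F S + F (i |: S)).
Proof.
rewrite (bigID (fun S : {set I} => i \in S)) /= addrC big_split /=; congr (_ + _).
rewrite (reindex_onto (fun S : {set I} => i |: S) (fun S => S :\ i)); last first.
  by move=> S iS; rewrite setD1K.
apply: eq_bigl => S; rewrite setU11 /=; apply/eqP/idP => [<-|iS].
  by rewrite !inE eqxx.
by rewrite setU1K.
Qed.

Lemma bern_weightU1 i S : i \notin S -> bern_weight (i |: S) = lam i * bern_weight S.
Proof.
move=> iS; rewrite /bern_weight (bigD1 i) //= [in RHS](bigD1 i) //=.
rewrite setU11 (negPf iS) !mulrA mulr1; congr (_ * _).
by apply: eq_bigr => j ji; rewrite in_setU1 (negPf ji).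
Qed.

(** Resampling a coordinate leaves the product law invariant. *)
Lemma bern_mean_resample i f : bern_mean (resample i f) = bern_mean f.
Proof.
rewrite /bern_mean !(sum_toggle i); apply: eq_bigr => S iS.
rewrite bern_weightU1 // /resample setU1K // (setUA _ _ S) setUid.
have -> : S :\ i = S by apply/setDidPl; rewrite disjoint_sym disjoints1.
by field; exact: lam1n.
Qed.

Lemma bern_mean_const (c : R) : bern_mean (fun=> c) = c.
Proof.
rewrite /bern_mean -mulr_suml.
have -> : \sum_S bern_weight S = \prod_i (lam i / (1 + lam i) + 1 / (1 + lam i)).
  rewrite bigA_distr; apply: eq_big => [S|S _]; first by rewrite inE.
  apply: eq_bigr => i _.
  by case: ifP.
by rewrite big1 ?mul1r // => i _; rewrite -mulrDl addrC divff.
Qed.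

Definition resample_seq s f := foldr resample f s.

Lemma resample_seq_const f S T s :
  (forall x, x \notin s -> (x \in S) = (x \in T)) ->
  resample_seq s f S = resample_seq s f T.
Proof.
elim: s S T => [|i s IH] S T ST.
  by congr f; apply/setP => x; rewrite ST.
rewrite /= /resample -!/(resample_seq _ _).
congr ((_ + _ * _) / _); apply: IH => x xs; rewrite !inE.
  by have [//|xi] := eqVneq x i; rewrite ST // inE negb_or xi.
by have [//|xi] := eqVneq x i; rewrite ST // inE negb_or xi.
Qed.

(** Once every coordinate has been resampled the function is constant, and its
    value is its mean under the product law. *)
Lemma resample_enum f S : resample_seq (enum I) f S = bern_mean f.
Proof.
have cst T : resample_seq (enum I) f T = resample_seq (enum I) f S.
  by apply: resample_seq_const => x; rewrite mem_enum.
have inv s : bern_mean (resample_seq s f) = bern_mean f.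
  by elim: s => //= i s <-; exact: bern_mean_resample.
rewrite -(inv (enum I)) -[LHS]bern_mean_const.
by apply: eq_bigr => T _; rewrite cst.
Qed.

Section Comparison.
Variables (X : finType) (A : {set X}) (W : X -> {set I}) (err : I -> R).
Hypothesis errP : forall i g, (forall S, `|g S| <= 1) -> (forall S, g (S :\ i) = g S) ->
  `|\sum_(x in A | i \in W x) g (W x) - lam i * \sum_(x in A | i \notin W x) g (W x)|
    <= err i.

(** Up to sign, [f] minus its resampled version is [g] on the sets that contain
    [i] and [- lam i * g] on the others, for the scaled difference [g] of the two
    values of [f]. *)
Lemma resample_error i f : (forall S, 0 <= f S <= 1) ->
  `|\sum_(x in A) f (W x) - \sum_(x in A) resample i f (W x)| <= err i.
Proof.
move=> f01; pose g S : R := (f (S :\ i) - f (i |: S)) / (1 + lam i).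
have g1 S : `|g S| <= 1.
  have /andP[a0 a1] := f01 (S :\ i); have /andP[b0 b1] := f01 (i |: S).
  rewrite normrM normfV (gtr0_norm (lam1 i)) ler_pdivrMr // mul1r.
  by rewrite ler_norml; have := lam0 i; lra.
have gi S : g (S :\ i) = g S.
  rewrite /g setDDl setUid; congr ((_ - f _) / _).
  by apply/setP => x; rewrite !inE; case: (x == i).
apply: le_trans (errP g1 gi); rewrite distrC.
rewrite -sumrB (bigID (fun x => i \in W x)) /= mulr_sumr -sumrN.
rewrite le_eqVlt; apply/orP; left; apply/eqP; congr (`| _ + _ |); apply: eq_bigr => x /andP[_ iW].
  rewrite /resample /g (setUidPr _) ?sub1set //.
  by field; exact: lam1n.
have -> : f (W x) = f (W x :\ i).
  by congr f; apply/esym/setDidPl; rewrite disjoint_sym disjoints1.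
by rewrite /resample /g; field; exact: lam1n.
Qed.

Lemma telescoping f : (forall S, 0 <= f S <= 1) ->
  `|\sum_(x in A) f (W x) - #|A|%:R * bern_mean f| <= \sum_i err i.
Proof.
move=> f01.
have r01 s S : 0 <= resample_seq s f S <= 1.
  elim: s S => [|i s IH] S //=; have /andP[a0 a1] := IH (S :\ i); have /andP[b0 b1] := IH (i |: S).
  apply/andP; split.
    by apply: divr_ge0; [apply: addr_ge0 => //; apply: mulr_ge0 | exact: ltW].
  by rewrite ler_pdivrMr // mul1r lerD // ler_piMr.
have tele s : `|\sum_(x in A) f (W x) - \sum_(x in A) resample_seq s f (W x)| <= \sum_(i <- s) err i.
  elim: s => [|i s IH]; first by rewrite subrr normr0 big_nil.
  rewrite big_cons [X in _ <= X]addrC.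
  apply: le_trans (ler_distD (\sum_(x in A) resample_seq s f (W x)) _ _) _.
  by apply: lerD IH _; exact: resample_error.
have := tele (enum I); rewrite big_enum /=.
under [X in _ - X]eq_bigr do rewrite resample_enum.
by rewrite sumr_const mulr_natl.
Qed.

End Comparison.

(** The union bound, for products of numbers in the unit interval. *)
Lemma prod_ge1Bsum (J : Type) (js : seq J) (u w : J -> R) :
 (forall k, 0 <= u k <= 1) -> (forall k, 1 - u k <= w k) ->
  1 - \sum_(k <- js) w k <= \prod_(k <- js) u k <= 1.
Proof.
move=> u01 uw; elim: js => [|k js /andP[IH1 IH2]]; first by rewrite !big_nil subr0 lexx.
rewrite !big_cons; have /andP[a0 a1] := u01 k; have := uw k.
set P := \prod_(_ <- js) _ in IH1 IH2 *; set Z := \sum_(_ <- js) _ in IH1 *.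
have P0 : 0 <= P by apply: prodr_ge0 => k' _; case/andP: (u01 k').
by move=> h; apply/andP; split; nra.
Qed.

Variable ex : I -> R.
Hypothesis ex_ge : forall i, 1 - lam i <= ex i.
Hypothesis ex_le : forall i, ex i * (1 + lam i) <= 1.
Hypothesis ex0 : forall i, 0 <= ex i.

(** The probability that independent Poisson variables form the indicator of [S],
    with [ex i] standing for [expR (- lam i)]. *)
Definition poisson_weight S : R := \prod_i (ex i * (if i \in S then lam i else 1)).

Lemma poisson_weight_le S : 0 <= poisson_weight S <= bern_weight S.
Proof.
apply/andP; split; first by apply: prodr_ge0 => i _; case: ifP => _; rewrite mulr_ge0.
apply: ler_prod => i _.
have l0 : 0 <= (if i \in S then lam i else 1) by case: ifP.
rewrite mulr_ge0 //= mulrC ler_wpM2l // -[_^-1]mul1r ler_pdivlMr //.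
Qed.

Lemma poisson_total : 1 - \sum_i lam i ^+ 2 <= \sum_S poisson_weight S <= 1.
Proof.
have -> : \sum_S poisson_weight S = \prod_i (ex i * lam i + ex i * 1).
  rewrite bigA_distr; apply: eq_big => [S|S _]; first by rewrite inE.
  apply: eq_bigr => i _.
  by case: ifP.
apply: prod_ge1Bsum => i; have := ex_le i; have := ex_ge i; have := ex0 i; have := lam0 i.
  by move=> a b c e; rewrite -mulrDr [lam i + 1]addrC e mulr_ge0 // ltW.
move=> a b c e; have : (1 - lam i) * (1 + lam i) <= ex i * (1 + lam i).
  by rewrite ler_wpM2r // ltW.
by lra.
Qed.

(** The Poisson weights lie below the Bernoulli ones and miss a total mass of at
    most the sum of the [lam i ^+ 2].  The value [z] stands for a Poisson
    probability of an event that extends [f] beyond the indicator vectors. *)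
Lemma poisson_compare f (z : R) : (forall S, 0 <= f S <= 1) ->
  let m := \sum_S poisson_weight S * f S in
  m <= z <= m + (1 - \sum_S poisson_weight S) ->
  `|bern_mean f - z| <= \sum_i lam i ^+ 2.
Proof.
move=> f01 m /andP[z1 z2]; have /andP[t1 t2] := poisson_total.
have bm : \sum_S bern_weight S = 1.
  by rewrite -[RHS](bern_mean_const 1); apply: eq_bigr => S _; rewrite mulr1.
have d0 : m <= bern_mean f.
  apply: ler_sum => S _; apply: ler_wpM2r; first by case/andP: (f01 S).
  by case/andP: (poisson_weight_le S).
have d1 : bern_mean f - m <= 1 - \sum_S poisson_weight S.
  rewrite -bm -!sumrB; apply: ler_sum => S _; rewrite -mulrBl ler_piMr //.
    by rewrite subr_ge0; case/andP: (poisson_weight_le S).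
  by case/andP: (f01 S).
by rewrite ler_norml; move: d0 d1 z1 z2 t1 t2; lra.
Qed.

End Telescoping.

(** * The number of cycles *)

Section CycleCount.
Import mathcomp.boot.fintype mathcomp.boot.finset.
Import Order.TTheory GRing.Theory Num.Theory.
Local Open Scope nat_scope.
Local Open Scope set_scope.
Variables (n : nat).

(** A cycle of length [k] is traced by its [k] rotated vertex sequences, which are
    distinct, and a sequence traces only one cycle. *)
Lemma card_cycles k : 0 < k ->
  k * #|[set B : {set {set 'I_n}} | is_cycle B & #|B| == k]| <= n ^_ k.
Proof.
move=> k0; set CC := [set B | _].
pose U := [set t : k.-tuple 'I_n | uniq t].
have cU : #|U| = n ^_ k.
  rewrite -[in RHS](card_ord n) -card_uniq_tuples; apply: eq_card => t.
  by rewrite !inE all_predT.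
rewrite -cU -[X in _ <= X]sum1_card mulnC -sum_nat_const.
apply: (@leq_trans (\sum_(B in CC) \sum_(t in U | closed_walk_edges t == B) 1)).
  apply: leq_sum => B; rewrite inE => /andP[cB /eqP cardB].
  have [/existsP[k' /existsP[s /and3P[k3 us /eqP sE]]]] := cB.
  have s3 : 2 < size s by rewrite size_tuple.
  move: (tval s) us s3 sE => q uq q3 sE.
  have sk : size q = k by rewrite -cardB sE card_closed_walk_edges.
  pose f (i : 'I_k) : k.-tuple 'I_n := Tuple (introT eqP (etrans (size_rot i q) sk)).
  have x0 : 'I_n by case: q sk {uq q3 sE f} k0 => [<-|x].
  rewrite sum1_card -[X in X <= _]card_ord -(card_imset (f := f)).
    apply/subset_leq_card/subsetP => _ /imsetP[i _ ->].
    apply/andP; split; first by rewrite inE /= rot_uniq.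
    by rewrite /= closed_walk_edges_rot // sE.
  move=> i j /(congr1 val); rewrite /= => E; apply/val_inj.
  have : nth x0 (rot i q) 0 = nth x0 (rot j q) 0 by rewrite E.
  have nr (l : 'I_k) : nth x0 (rot l q) 0 = nth x0 q l.
    by rewrite nth_cat size_drop sk subn_gt0 ltn_ord nth_drop addn0.
  by rewrite !nr => /eqP; rewrite nth_uniq ?sk // => /eqP.
rewrite [X in _ <= X](partition_big (fun t : k.-tuple 'I_n => closed_walk_edges t) predT) //=.
by rewrite [X in _ <= X](bigID (fun B => B \in CC)) /= leq_addr.
Qed.

End CycleCount.

(** * Short cycles of a random regular graph *)

Section CycleIndicators.
Import mathcomp.boot.fintype mathcomp.boot.finset.
Import Order.TTheory GRing.Theory Num.Theory.
Local Open Scope set_scope.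
Local Open Scope ring_scope.
Variables (R : realFieldType) (n d r : nat).
Local Notation D := d.-1.
Hypothesis d2 : (2 < d)%N.
Hypothesis r2 : (2 < r)%N.
Hypothesis nbig : (1000 * D ^ (2 * r - 1) <= n)%N.
Local Notation I := (cycle_index n r).
Local Notation eta := ((D ^ r.-1)%:R / n%:R : R).

Definition cycle_rate (a : I) : R := D%:R ^+ #|val a| / (n ^_ #|val a|)%:R.

Definition cycles_in (G : graph n) : {set I} := [set a : I | val a \subset G].

Lemma cycle_indexP (a : I) : is_cycle (val a) /\ (#|val a| <= r)%N.
Proof. by have := valP a; rewrite inE => /andP[]. Qed.

Lemma leq_rn : (r <= n)%N.
Proof.
have := nbig12 d2 r2 nbig; have := leq_expn_pred d2 r2.
by clear; lia.
Qed.

Lemma cycle_rate_gt0 a : 0 < cycle_rate a.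
Proof.
have [_ ar] := cycle_indexP a.
rewrite divr_gt0 ?exprn_gt0 ?ltr0n ?ffact_gt0 //.
  by move: d2; clear; lia.
by apply: leq_trans ar leq_rn.
Qed.

(** The factor [k] is exactly compensated by the number of cycles, so that each
    length contributes at most [D ^ k]. *)
Lemma sum_cycle_rate : \sum_a cycle_rate a * #|val a|%:R <= 2 * (D ^ r)%:R.
Proof.
have sz a : (#|val (a : I)| < r.+1)%N by rewrite ltnS; have [] := cycle_indexP a.
rewrite (partition_big (fun a : I => Ordinal (sz a)) predT) //=.
apply: (@le_trans _ _ (\sum_(k < r.+1) if k == 0 :> nat then 0 else (D ^ k)%:R)); last first.
  rewrite big_ord_recl /= add0r -natr_sum -(natrM _ 2) ler_nat.
  exact: geom_sum d2 r.
apply: ler_sum => k _.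
pose c : R := D%:R ^+ k / (n ^_ k)%:R * k%:R.
rewrite (eq_bigr (fun=> c)); last by move=> a /eqP/(congr1 val) /= E; rewrite /c -E.
rewrite sumr_const -[X in X <= _]mulr_natr /c.
have [->|k0] := eqVneq (k : nat) 0%N; first by rewrite mulr0 mul0r.
have nk0 : 0 < (n ^_ k)%:R :> R.
  by rewrite ltr0n ffact_gt0; apply: leq_trans leq_rn; rewrite -ltnS.
rewrite -!mulrA mulrC -natrX -[X in _ <= X]mul1r ler_wpM2r //.
rewrite mulrC ler_pdivrMr // mul1r -natrM ler_nat.
apply: leq_trans (card_cycles n _); last by rewrite lt0n.
rewrite leq_mul2l -(card_in_imset (f := val)); last by move=> ? ? _ _; apply: val_inj.
apply/orP; right; apply/subset_leq_card/subsetP => _ /imsetP[a ak ->].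
rewrite inE; have [-> _] := cycle_indexP a.
by move: ak; rewrite unfold_in /= => /eqnP /= ->.
Qed.

Lemma cycles_in_approx (f : {set I} -> R) : (forall S, 0 <= f S <= 1) ->
  `|\sum_(G in regular_graphs n d) f (cycles_in G)
     - #|regular_graphs n d|%:R * bern_mean cycle_rate f|
    <= #|regular_graphs n d|%:R * (700 * (eta * (D ^ r)%:R)).
Proof.
move=> f01; set A := regular_graphs n d.
have eta0 : 0 <= eta by rewrite divr_ge0 ?ler0n.
have RG0 : regular_over d (set0 : {set {set 'I_n}}) = A.
  by apply/setP => G; rewrite in_regular_over sub0set andbT.
pose err a : R := cycle_rate a * #|val a|%:R * (350 * eta) * #|A|%:R.
have lam0 a : 0 <= cycle_rate a by apply: ltW (cycle_rate_gt0 a).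
apply: le_trans (telescoping lam0 (err := err) _ f01) _; last first.
  rewrite /err -!mulr_suml.
  have := sum_cycle_rate; set s := \sum_(_ | _) _ => hs.
  have : s * (350 * eta) * #|A|%:R <= 2 * (D ^ r)%:R * (350 * eta) * #|A|%:R.
    by apply: ler_wpM2r => //; apply: ler_wpM2r => //; rewrite mulr_ge0.
  by move=> h; apply: le_trans h _; rewrite le_eqVlt; apply/orP; left; apply/eqP; ring.
move=> a g g1 ga; have [ca ar] := cycle_indexP a.
pose h (G : {set {set 'I_n}}) := g (cycles_in G).
have h1 G : `|h G| <= 1 by apply: g1.
have h_al (G G' : {set {set 'I_n}}) : (forall B : {set {set 'I_n}}, is_cycle B -> (#|B| <= r)%N -> B != val a ->
    (B \subset G) = (B \subset G')) -> h G = h G'.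
  move=> GG'; rewrite /h -ga -[RHS]ga; congr g; apply/setP => b; rewrite !inE.
  have [//|ba] := eqVneq b a; have [cb br] := cycle_indexP b.
  by rewrite GG' // (inj_eq val_inj).
have [+ _] := cycle_insertion d2 r2 nbig h1 h_al ca erefl ar.
rewrite /hsum RG0.
have E1 : \sum_(G in regular_over d (val a)) h G = \sum_(G in A | a \in cycles_in G) h G.
  by apply: eq_bigl => G; rewrite in_regular_over [a \in _]inE.
have -> : \sum_(G in A) h G - \sum_(G in regular_over d (val a)) h G =
    \sum_(G in A | a \notin cycles_in G) h G.
  by rewrite E1 [X in X - _](bigID (fun G => a \in cycles_in G)) /= addrAC subrr add0r.
by rewrite E1.
Qed.

Lemma sum_cycle_rate_sqr : \sum_a cycle_rate a ^+ 2 <= 4 * (eta * (D ^ r)%:R).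
Proof.
apply: (@le_trans _ _ (\sum_a 2 * eta * (cycle_rate a * #|val a|%:R))); last first.
  rewrite -mulr_sumr.
  have : 2 * eta * (\sum_a cycle_rate a * #|val a|%:R) <= 2 * eta * (2 * (D ^ r)%:R).
    by rewrite ler_wpM2l ?sum_cycle_rate // mulr_ge0 // divr_ge0 ?ler0n.
  by lra.
apply: ler_sum => a _; have [ca ar] := cycle_indexP a.
have [] := @cycle_insertion R n d r d2 r2 nbig (val a) (fun=> 0) _ _ _ ca erefl ar.
- by move=> G; rewrite normr0.
- by [].
move=> _ le; rewrite expr2; apply: ler_pM; rewrite ?(ltW (cycle_rate_gt0 a)) //.
rewrite ler_peMr ?(ltW (cycle_rate_gt0 a)) // ler1n card_gt0.
case/existsP: ca => k /existsP[s /and3P[k3 us /eqP ->]].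
by rewrite -card_gt0 card_closed_walk_edges // size_tuple //; apply: leq_trans k3.
Qed.

End CycleIndicators.

(** * From finite sums to laws of random vectors *)

Section Measures.
Import Order.TTheory GRing.Theory Num.Theory.
Local Open Scope classical_set_scope.
Local Open Scope ring_scope.

Lemma measure_points dT (T : measurableType dT) (R : realType)
    (mu : {measure set T -> \bar R}) (J : finType) (x : J -> T) (p : pred J) :
  injective x -> (forall j, measurable [set x j]) ->
  mu [set t | exists2 j, p j & t = x j] = (\sum_(j | p j) mu [set x j])%E.
Proof.
move=> injx mx.
have -> : (\sum_(j | p j) mu [set x j] = \sum_(j <- [seq j <- enum J | p j]) mu [set x j])%E.
  by rewrite big_filter big_enum_cond.
have -> : [set t | exists2 j, p j & t = x j] =
    [set t | exists2 j, j \in [seq j <- enum J | p j] & t = x j].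
  by apply/seteqP; split=> t [j pj ->]; exists j => //; move: pj; rewrite mem_filter mem_enum andbT.
have : uniq [seq j <- enum J | p j] by rewrite filter_uniq ?enum_uniq.
elim: [seq j <- enum J | p j] => [_|j s IH].
  rewrite big_nil (_ : [set t | _] = set0) ?measure0 //.
  by apply/seteqP; split=> t // [].
rewrite cons_uniq => /andP[js us]; rewrite big_cons -IH //.
have mseq (q : seq J) : measurable [set t | exists2 j, j \in q & t = x j].
  elim: q => [|i q IHq].
    rewrite (_ : [set t | _] = set0); first exact: measurable0.
    by apply/seteqP; split=> t // [].
  rewrite (_ : [set t | _] = [set x i] `|` [set t | exists2 j, j \in q & t = x j]).
    exact: measurableU.
  apply/seteqP; split=> t.
    by case=> k; rewrite inE => /orP[/eqP->|kq] ->; [left | right; exists k].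
  by case=> [->|[k kq ->]]; [exists i; rewrite ?mem_head | exists k; rewrite // inE kq orbT].
rewrite -measureU //; last first.
  apply/seteqP; split=> t // [-> [k ks /injx jk]].
  by move: js; rewrite jk ks.
congr (mu _); apply/seteqP; split=> t.
  by case=> k; rewrite inE => /orP[/eqP->|kq] ->; [left | right; exists k].
by case=> [->|[k kq ->]]; [exists j; rewrite ?mem_head | exists k; rewrite // inE kq orbT].
Qed.

Definition indicator_vector (I : finType) (S : {set I}) : count_vector I :=
  [ffun i => (i \in S) : nat].

Lemma indicator_vector_inj (I : finType) : injective (@indicator_vector I).
Proof.
move=> S T /ffunP E; apply/setP => i; have := E i.
by rewrite !ffunE; case: (i \in S); case: (i \in T).
Qed.

Section Laws.
Variables (R : realType) (n r : nat).
Local Notation I := (cycle_index n r).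
Variable A : set (count_vector I).

Definition event_test (S : {set I}) : R := (`[< A (indicator_vector S) >])%:R.

Lemma event_test01 S : 0 <= event_test S <= 1.
Proof. by rewrite /event_test; case: asbool; rewrite ler01 lexx. Qed.

Lemma law_cycle_indicators d dG (TG : measurableType dG) (P : probability TG R)
    (G : {RV P >-> graph n}) :
  uniform_on (regular_graphs n d) (distribution P G) ->
  let X (a : I) : {RV P >-> nat} := cycle_indicator (val a) \o G in
  distribution P (random_vector X) A =
    ((#|regular_graphs n d|%:R)^-1 *
      \sum_(g in regular_graphs n d) event_test (cycles_in r g))%:E.
Proof.
move=> unif X.
have -> : distribution P (random_vector X) A =
   distribution P G [set t | exists2 j, `[< A (indicator_vector (cycles_in r j)) >] & t = j].
  rewrite /distribution /pushforward /=; congr (P _); apply/seteqP.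
  have E w : random_vector X w =
      indicator_vector (cycles_in r (G w)).
    by apply/ffunP => a; rewrite !ffunE inE.
  split=> w /=; rewrite E; first by move=> Aw; exists (G w) => //; apply/asboolP.
  by case=> j /asboolP Aj ->.
rewrite (@measure_points _ (graph n) _ _ (graph n) id) //.
rewrite (eq_bigr (fun g : graph n =>
  (if g \in regular_graphs n d then (#|regular_graphs n d|%:R)^-1 else 0 : R)%:E)); last first.
  by move=> g _; exact: unif.
rewrite sumEFin; congr EFin; rewrite mulr_sumr big_mkcond [RHS]big_mkcond /=.
apply: eq_bigr => g _; rewrite /event_test.
by case: asbool; case: ifP => // _; rewrite ?mulr1 ?mulr0.
Qed.

Lemma law_poisson_points dZ (TZ : measurableType dZ) (Q : probability TZ R)
    (Z : I -> {RV Q >-> nat}) (lam : I -> R) S :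
  (forall a, 0 < lam a) ->
  (forall a, is_poisson (lam a) (distribution Q (Z a))) ->
  mutually_independent Z ->
  distribution Q (random_vector Z) [set indicator_vector S] =
    (poisson_weight lam (fun a => expR (- lam a)) S)%:E.
Proof.
move=> lam0 pois indep.
have mk (a : I) : measurable [set ((a \in S) : nat)] by [].
have E : random_vector Z @^-1` [set indicator_vector S] =
    \bigcap_(a in [set` (finset.setT : {set I})]) (Z a @^-1` [set ((a \in S) : nat)]).
  apply/seteqP; split=> w /=.
    by move=> /ffunP h a _ /=; have := h a; rewrite !ffunE.
  by move=> h; apply/ffunP => a; rewrite !ffunE; apply: h; rewrite /= inE.
rewrite /distribution /pushforward /= E indep //; congr EFin.
rewrite /poisson_weight big_mkcond /=; apply: eq_bigr => a _; rewrite inE.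
have -> : Q (Z a @^-1` [set ((a \in S) : nat)]) = (poisson_pmf (lam a) (a \in S))%:E.
  exact: pois.
rewrite /= /poisson_pmf lam0; case: (a \in S) => /=.
  by rewrite expr1 invr1 mulr1 mulrC.
by rewrite expr0 invr1 !mul1r mulr1.
Qed.

(** The mass outside the indicator vectors, where some coordinate exceeds 1, is
    not computed: it is nonnegative and at most the total missing mass. *)
Lemma law_poisson_bounds dZ (TZ : measurableType dZ) (Q : probability TZ R)
    (Z : I -> {RV Q >-> nat}) (lam : I -> R) :
  (forall a, 0 < lam a) ->
  (forall a, is_poisson (lam a) (distribution Q (Z a))) ->
  mutually_independent Z ->
  let w := poisson_weight lam (fun a => expR (- lam a)) in
  let m := \sum_S w S * event_test S in
  exists2 z : R, distribution Q (random_vector Z) A = z%:E &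
    m <= z <= m + (1 - \sum_S w S).
Proof.
move=> lam0 pois indep w m.
pose nu : probability (count_vector I) R := distribution Q (random_vector Z).
have nuS S : nu [set indicator_vector S] = (w S)%:E by exact: law_poisson_points.
pose F := [set t : count_vector I | exists2 S : {set I}, true & t = indicator_vector S].
have mF B : nu [set t | exists2 S, `[< B (indicator_vector S) >] & t = indicator_vector S] =
    (\sum_S w S * (`[< B (indicator_vector S) >])%:R)%:E.
  rewrite measure_points //; last exact: indicator_vector_inj.
  rewrite (eq_bigr (fun S => (w S)%:E)); last by move=> S _; exact: nuS.
  rewrite sumEFin big_mkcond /=; congr EFin; apply: eq_bigr => S _.
  by case: asbool; rewrite ?mulr1 ?mulr0.
have nuF : nu F = (\sum_S w S)%:E.
  rewrite /F measure_points //; last exact: indicator_vector_inj.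
  by rewrite (eq_bigr (fun S => (w S)%:E)) ?sumEFin // => S _; exact: nuS.
have nuAF : nu (A `&` F) = m%:E.
  rewrite /m -mF; congr (nu _); apply/seteqP; split=> t.
    by case=> At [S _ tE]; exists S => //; apply/asboolP; rewrite -tE.
  by case=> S /asboolP AS ->; split => //; exists S.
have nuC : nu (~` F) = (1 - \sum_S w S)%:E.
  by rewrite probability_setC // nuF EFinB.
have split_A : nu A = (m%:E + nu (A `\` F))%E.
  rewrite -nuAF -measureU //; first by rewrite setUIDK.
  by apply/seteqP; split=> t // [[_ Ft] [_ /(_ Ft)]].
have le2 : (nu (A `\` F) <= (1 - \sum_S w S)%:E)%E.
  by rewrite -nuC; apply: le_measure; rewrite ?inE // => t [].
have ge2 : (0 <= nu (A `\` F))%E by apply: measure_ge0.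
have fin : nu (A `\` F) \is a fin_num by apply: fin_num_measure.
exists (m + fine (nu (A `\` F))).
  by rewrite -[LHS]/(nu A) split_A EFinD fineK.
rewrite lerDl lerD2l -!lee_fin fineK //.
by rewrite ge2 le2.
Qed.

End Laws.
End Measures.

(** * The total variation bound *)

Section TotalVariation.
Import Order.TTheory GRing.Theory Num.Theory.
Local Open Scope ring_scope.

Lemma event_dist_le1 dT (T : measurableType dT) (R : realType) (mu nu : probability T R)
  (A : set T) : measurable A -> (`|mu A - nu A| <= 1)%E.
Proof.
move=> mA; have val (k : probability T R) : exists2 x : R, k A = x%:E & 0 <= x <= 1.
  have fk : k A \is a fin_num by apply: fin_num_measure.
  exists (fine (k A)); first by rewrite fineK.
  by rewrite -!lee_fin fineK // measure_ge0 probability_le1.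
have [x -> /andP[x0 x1]] := val mu; have [y -> /andP[y0 y1]] := val nu.
by rewrite -EFinB abse_EFin lee_fin ler_norml; lra.
Qed.

Lemma event_subsingleton dT (T : measurableType dT) (R : realType) (mu nu : probability T R)
  (A : set T) : (forall x y : T, x = y) -> mu A = nu A.
Proof.
move=> T1; have [->|/set0P[x Ax]] := eqVneq A classical_sets.set0; first by rewrite !measure0.
have -> : A = classical_sets.setT by apply/seteqP; split=> y // _; rewrite (T1 y x).
by rewrite !probability_setT.
Qed.

Lemma cycle_length n (B : {set {set 'I_n}}) : is_cycle B -> (2 < n)%N.
Proof.
by case/existsP => k /existsP[s /and3P[k3 _ _]]; rewrite -ltnS (leq_trans _ (ltn_ord k)).
Qed.

Lemma event_dist_bound (R : realType) n d r (A : set (count_vector (cycle_index n r)))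
    dG (TG : measurableType dG) (P : probability TG R) (G : {RV P >-> graph n})
    dZ (TZ : measurableType dZ) (Q : probability TZ R)
    (Z : cycle_index n r -> {RV Q >-> nat}) :
  (2 < d)%N -> (2 < r)%N -> (1000 * d.-1 ^ (2 * r - 1) <= n)%N ->
  regular_graphs n d != finset.set0 ->
  uniform_on (regular_graphs n d) (distribution P G) ->
  (forall a, is_poisson (cycle_rate R d a) (distribution Q (Z a))) ->
  mutually_independent Z ->
  let X (a : cycle_index n r) : {RV P >-> nat} := cycle_indicator (val a) \o G in
  (`|distribution P (random_vector X) A - distribution Q (random_vector Z) A|
    <= (1000 * ((d.-1 ^ (2 * r - 1))%:R / n%:R))%:E)%E.
Proof.
move=> d2 r2 nbig RG0 unif pois indep; cbv zeta.
rewrite (law_cycle_indicators A unif).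
have lam0 (a : cycle_index n r) : 0 < cycle_rate R d a := cycle_rate_gt0 R d2 r2 nbig a.
have lam0' (a : cycle_index n r) : 0 <= cycle_rate R d a := ltW (lam0 a).
have := law_poisson_bounds A lam0 pois indep; cbv zeta => -[z zE zP].
rewrite [in X in `|_ - X|%E]zE.
pose ex (a : cycle_index n r) : R := expR (- cycle_rate R d a).
have ex_ge (a : cycle_index n r) : 1 - cycle_rate R d a <= ex a by exact: expR_ge1Dx.
have ex_le (a : cycle_index n r) : ex a * (1 + cycle_rate R d a) <= 1.
  rewrite /ex expRN mulrC ler_pdivrMr ?expR_gt0 // mul1r; exact: expR_ge1Dx.
have ex0 a : 0 <= ex a by apply: expR_ge0.
have f01 := @event_test01 R n r A.
have b1 := poisson_compare lam0' ex_ge ex_le ex0 f01 zP.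
have b2 := sum_cycle_rate_sqr R d2 r2 nbig.
have b3 := cycles_in_approx d2 r2 nbig f01.
set M : R := #|regular_graphs n d|%:R in b3 *.
have M0 : 0 < M by rewrite ltr0n card_gt0.
set s := \sum_(g in regular_graphs n d) _ in b3 *.
set m := bern_mean _ _ in b1 b3.
have b4 : `|M^-1 * s - m| <= 700 * ((d.-1 ^ r.-1)%:R / n%:R * (d.-1 ^ r)%:R).
  by rewrite -(ler_pM2l M0) -[X in X * `|_|](gtr0_norm M0) -normrM mulrBr mulVKf // lt0r_neq0.
have -> : (d.-1 ^ (2 * r - 1))%:R / n%:R = (d.-1 ^ r.-1)%:R / n%:R * (d.-1 ^ r)%:R :> R.
  rewrite mulrAC -natrM -expnD; congr ((d.-1 ^ _)%:R / _).
  by move: r2; clear; lia.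
rewrite -EFinB abse_EFin lee_fin.
apply: le_trans (ler_distD m _ _) _.
have e0 : 0 <= (d.-1 ^ r.-1)%:R / n%:R * (d.-1 ^ r)%:R :> R.
  by rewrite mulr_ge0 ?divr_ge0.
by move: b1 b2 b4 e0; lra.
Qed.

End TotalVariation.

Theorem theorem2p3 (R : realType) :
  exists c : R, forall n d r : nat,
    (3 <= d)%N -> (3 <= r)%N -> regular_graphs n d != finset.set0 ->
    forall (dG : measure_display) (TG : measurableType dG)
      (P : probability TG R) (G : {RV P >-> graph n})
      (dZ : measure_display) (TZ : measurableType dZ)
      (Q : probability TZ R) (Z : cycle_index n r -> {RV Q >-> nat}),
    uniform_on (regular_graphs n d) (distribution P G) ->
    (forall a : cycle_index n r,
        is_poisson ((d%:R - 1) ^+ #|val a| / (n ^_ #|val a|)%:R)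
                   (distribution Q (Z a))) ->
    mutually_independent Z ->
    let I (a : cycle_index n r) : {RV P >-> nat} :=
      cycle_indicator (val a) \o G in
    (total_variation_dist (distribution P (random_vector I))
                          (distribution Q (random_vector Z))
     <= (c * (d%:R - 1) ^+ (2 * r - 1) / n%:R)%:E)%E.
Proof.
exists 1000%:R => n d r d2 r2 RG0 dG TG P G dZ TZ Q Z unif pois indep; cbv zeta.
have predE : d%:R - 1 = d.-1%:R :> R.
  by rewrite -[in LHS](ltn_predK d2) -GRing.natr1 GRing.addrK.
apply: ge_ereal_sup => _ [A mA <-].
rewrite predE -GRing.natrX -GRing.mulrA.
have [nbig|nsmall] := leqP (1000 * d.-1 ^ (2 * r - 1)) n.
  apply: event_dist_bound => // a.
  by have := pois a; rewrite predE.
(* Division by zero makes the bound vanish when [n = 0], but then there are no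
   cycles and the random vectors take only one value. *)
case: (posnP n) => [n0|n0].
  rewrite [X in (`|X - _|)%E](@event_subsingleton _ _ _ _ (distribution Q (random_vector Z))).
    rewrite subee ?abse0 ?lee_fin ?n0 ?GRing.invr0 ?GRing.mulr0 //.
    by apply: fin_num_measure.
  move=> x y; apply/ffunP => a; have [/cycle_length n3 _] := cycle_indexP a.
  by rewrite n0 in n3.
apply: Order.POrderTheory.le_trans (event_dist_le1 _ _ mA) _.
rewrite lee_fin GRing.mulrA Num.Theory.ler_pdivlMr ?Num.Theory.ltr0n // GRing.mul1r.
by rewrite -GRing.natrM Num.Theory.ler_nat ltnW.
Qed.
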